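(* Let $(I,d,(I_n)_n)$ be a uniform metric index set, $W$ a compact Hausdorff space and $m:\mathcal{F}[I]\to C^*(W)$ a frame measure function. Suppose $\mathcal{F}_1,\mathcal{F}_2\in\mathcal{F}[I]$ are non-expansive frames such that $(\mathcal{F}_1,\mathcal{F}_2)$ is a superframe. Then $\mathcal{F}_1\oplus\mathcal{F}_2$ is non-expansive and $m(\mathcal{F}_1\oplus\mathcal{F}_2)=m(\mathcal{F}_1)+m(\mathcal{F}_2)$.
   Context: $I$ countable with nested finite subsets $I_1\subset I_2\subset\cdots$, $\bigcup I_n=I$, and a quasi-distance $d$ ($d\ge0$, $d(i,i)=0$, symmetric, triangle inequality); $B_R(i)=\{j:d(j,i)\le R\}$. $(I,d,(I_n))$ is a uniform metric index set if $\sup_i|B_R(i)|<\infty$ and $\lim_n|(\bigcup_{j\in I\setminus I_n}B_R(j))\cap I_n|/|I_n|=0$ for all $R>0$. $\mathcal{F}[I]$: families $\{f_i\}_{i\in I}$ in a separable Hilbert space that are frames for their closed span; $\tilde f_i=S^{-1}f_i$ canonical dual; $b(\mathcal{F})=(\sum_{i\in I_n}\langle f_i,\tilde f_i\rangle)_n$. The associated Gram projection of $\mathcal{F}$ is the orthogonal projection of $\ell^2(I)$ onto the range of the analysis operator $h\mapsto(\langle h,f_i\rangle)_{i\in I}$ (equivalently onto the range of the Gram operator). An operator $A$ on $\ell^2(I)$ with canonical basis $\{\delta_i\}$ is row non-expansive if for all $\varepsilon>0$ there is $N$ with $\sum_{j\notin B_N(i)}|\langle A\delta_i,\delta_j\rangle|^2<\varepsilon$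 for all $i$; non-expansive if $A,A^*$ both are; a frame is non-expansive if its associated Gram projection is. For $\mathcal{F}_k=\{f^k_i\}$ with closed spans $H_k$, $\mathcal{F}_1\oplus\mathcal{F}_2=\{f^1_i\oplus f^2_i\}\subset H_1\oplus H_2$, and $(\mathcal{F}_1,\mathcal{F}_2)$ is a superframe if $\mathcal{F}_1\oplus\mathcal{F}_2$ is a frame for $H_1\oplus H_2$. Frame compatible sequences: nonnegative $\mathbf{x}$ with $0\le x_1\le|I_1|$, $0\le x_i-x_{i-1}\le|I_i\setminus I_{i-1}|$; $X$ their set, $X^+=\{c\mathbf{x}\}_{c\ge0}$, $X^{\mathbb{R}}=X^+-X^+$; $\mathbf{x}\approx\mathbf{y}$ iff $\lim(x_n-y_n)/|I_n|=0$; $\mathbf{y}\leqq\mathbf{x}$ iff $\liminf(x_n-y_n)/|I_n|\ge0$. $C^*(W)$: real continuous functions. A sequence measure function is a linear $m:X^{\mathbb{R}}\to C^*(W)$ with $m(\mathbf{x})=m(\mathbf{y})\iff\mathbf{x}\approx\mathbf{y}$ on $X^{\mathbb{R}}$, $m(\mathbf{x})\le m(\mathbf{y})\iff\mathbf{x}\leqq\mathbf{y}$ on $X^+$, $m((|I_1|,|I_2|,\dots))=1$; a frame measure function is $\mathcal{F}\mapsto m(b(\mathcal{F}))$. *)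

(* Defs.v *)
From HB Require Import structures.
From Stdlib Require Import ClassicalEpsilon.
From mathcomp Require Import all_boot all_order all_algebra finmap.
From mathcomp Require Import complex.
From mathcomp Require Import boolp classical_sets functions reals ereal topology
  normedtype sequences esum.

Set Implicit Arguments.
Unset Strict Implicit.
Unset Printing Implicit Defensive.

Import Order.TTheory GRing.Theory Num.Theory.
Import numFieldNormedType.Exports.
Local Open Scope ring_scope.
Local Open Scope classical_set_scope.

Section Defs.
Variable R : realType.
Local Notation C := (R[i]).
Local Notation normc := (@ComplexField.Normc.normc R).

Section Index.
Variables (I : countType) (d : I -> I -> R) (In : nat -> {fset I}).

Definition quasi_distance :=
  [/\ forall i j, 0 <= d i j, forall i, d i i = 0,
      forall i j, d i j = d j i & forall i j k, d i k <= d i j + d j k].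

Definition nested_exhaustion :=
  (forall n, (In n `<=` In n.+1)%fset) /\ (forall i, exists n, i \in In n).

Definition boundary_part (r : R) (n : nat) : {fset I} :=
  [fset i in In n | `[< exists j, j \notin In n /\ d i j <= r >]]%fset.

Definition uniform_metric_index_set :=
  [/\ quasi_distance, nested_exhaustion,
      (forall r : R, 0 < r -> exists K : nat, forall (i : I) (S : {fset I}),
          (forall j, j \in S -> d j i <= r) -> (#|` S| <= K)%N) &
      (forall r : R, 0 < r ->
          (fun n => (#|` boundary_part r n|%:R / #|` In n|%:R : R)) @ \oo --> (0 : R))].

(* sequences are indexed from 0: x 0 corresponds to x_1 of the paper *)
Definition frame_compatible (x : nat -> R) :=
  (0 <= x 0%N <= #|` In 0%N|%:R) /\
  (forall n, 0 <= x n.+1 - x n <= #|` (In n.+1 `\` In n)%fset|%:R).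

Definition Xplus (x : nat -> R) :=
  exists (c : R) (y : nat -> R), 0 <= c /\ frame_compatible y /\ x = (fun n => c * y n).

Definition XR (x : nat -> R) :=
  exists y z, Xplus y /\ Xplus z /\ x = (fun n => y n - z n).

Definition seq_approx (x y : nat -> R) :=
  (fun n => (x n - y n) / #|` In n|%:R) @ \oo --> (0 : R).

Definition seq_leqq (y x : nat -> R) :=
  (0 <= limn_einf (fun n => ((x n - y n) / #|` In n|%:R)%:E))%E.

Definition seq_measure_function (W : topologicalType) (m : (nat -> R) -> W -> R) :=
  [/\ (forall x, XR x -> continuous (m x)),
      (forall (a b : R) x y, XR x -> XR y ->
          m (fun n => a * x n + b * y n) = (fun w => a * m x w + b * m y w)),
      (forall x y, XR x -> XR y -> (m x = m y <-> seq_approx x y)),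
      (forall x y, Xplus x -> Xplus y -> ((forall w, m x w <= m y w) <-> seq_leqq x y)) &
      m (fun n => #|` In n|%:R) = (fun _ => 1)].

Definition cvgC (u : nat -> C) (l : C) :=
  forall e : R, 0 < e -> exists N, forall n, (N <= n)%N -> normc (u n - l) < e.

Definition psum (a : I -> C) (n : nat) : C := \sum_(i <- In n) a i.

Section Hilbert.
Variables (V : lmodType C) (ip : V -> V -> C).

Definition nsq (x : V) : R := complex.Re (ip x x).
Definition nrm (x : V) : R := Num.sqrt (nsq x).

Definition is_hilbert :=
  [/\ (forall (a : C) x y z, ip (a *: x + y) z = a * ip x z + ip y z),
      (forall x y, ip y x = conjc (ip x y)),
      (forall x, x != 0 -> 0 < nsq x),
      (forall u : nat -> V,
          (forall e : R, 0 < e -> exists N, forall m n, (N <= m)%N -> (N <= n)%N ->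
              nrm (u m - u n) < e) ->
          exists v, forall e : R, 0 < e -> exists N, forall n, (N <= n)%N -> nrm (u n - v) < e) &
      (exists s : nat -> V, forall v (e : R), 0 < e -> exists n, nrm (v - s n) < e)].

Variable f : I -> V.

Definition in_cspan (v : V) :=
  forall e : R, 0 < e -> exists (s : seq I) (c : I -> C),
    nrm (v - \sum_(j <- s) c j *: f j) < e.

Definition frame_for (P : V -> Prop) :=
  exists A B : R, [/\ 0 < A, 0 < B & forall h, P h ->
    ((A * nsq h)%:E <= \esum_(i in [set: I]) ((normc (ip h (f i)) ^+ 2)%:E))%E /\
    (\esum_(i in [set: I]) ((normc (ip h (f i)) ^+ 2)%:E) <= (B * nsq h)%:E)%E].

Definition in_FI := frame_for in_cspan.

(* canonical dual: g in the closed span with S g = f_i (S the frame operator) *)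
Definition dual_pred (i : I) (g : V) :=
  in_cspan g /\
  forall h, cvgC (psum (fun j => ip g (f j) * ip (f j) h)) (ip (f i) h).

Definition cdual (i : I) : V := epsilon (inhabits 0) (dual_pred i).

(* b(F)_n = sum_{i in I_n} <f_i, f~_i>  (a real number) *)
Definition frame_b (n : nat) : R := complex.Re (\sum_(i <- In n) ip (f i) (cdual i)).

Definition l2 (x : I -> C) :=
  (\esum_(k in [set: I]) ((normc (x k) ^+ 2)%:E) < +oo)%E.

Definition delta (i k : I) : C := if k == i then 1 else 0.

(* x = P delta_i, where P is the orthogonal projection onto the closure of
   the range of the analysis operator T h = (<h, f_k>)_k *)
Definition gram_pred (i : I) (x : I -> C) :=
  [/\ l2 x,
      (forall e : R, 0 < e -> exists h : V,
          (\esum_(k in [set: I]) ((normc (x k - ip h (f k)) ^+ 2)%:E) < e%:E)%E) &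
      (forall h : V, cvgC (psum (fun k => (delta i k - x k) * conjc (ip h (f k)))) 0)].

Definition gram (i j : I) : C := epsilon (inhabits (fun _ => 0)) (gram_pred i) j.

End Hilbert.

Definition row_nonexpansive (a : I -> I -> C) :=
  forall e : R, 0 < e -> exists N : R, forall i : I,
    (\esum_(j in [set j | ~ (d j i <= N)%R]) ((normc (a i j) ^+ 2)%:E) < e%:E)%E.

(* entries of A^* : <A^* delta_i, delta_j> = conj <A delta_j, delta_i> *)
Definition adjoint_entries (a : I -> I -> C) : I -> I -> C :=
  fun i j => conjc (a j i).

Definition nonexpansive (a : I -> I -> C) :=
  row_nonexpansive a /\ row_nonexpansive (adjoint_entries a).

Definition nonexpansive_frame (V : lmodType C) (ip : V -> V -> C) (f : I -> V) :=
  nonexpansive (gram ip f).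

Definition dsum_ip (V1 V2 : lmodType C) (ip1 : V1 -> V1 -> C) (ip2 : V2 -> V2 -> C)
  (p q : (V1 * V2)%type) : C := ip1 p.1 q.1 + ip2 p.2 q.2.

Definition dsum_frame (V1 V2 : lmodType C) (f1 : I -> V1) (f2 : I -> V2) : I -> (V1 * V2)%type :=
  fun i => (f1 i, f2 i).

Definition superframe (V1 V2 : lmodType C) (ip1 : V1 -> V1 -> C) (ip2 : V2 -> V2 -> C)
  (f1 : I -> V1) (f2 : I -> V2) :=
  frame_for (dsum_ip ip1 ip2) (dsum_frame f1 f2)
    (fun p => in_cspan ip1 f1 p.1 /\ in_cspan ip2 f2 p.2).

End Index.
End Defs.

(* Main.v *)
Require Import Defs.
From HB Require Import structures.
From Stdlib Require Import ClassicalEpsilon.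
From mathcomp Require Import all_boot all_order all_algebra finmap.
From mathcomp Require Import complex.
From mathcomp Require Import boolp classical_sets functions reals ereal topology
  normedtype sequences esum fsbigop cardinality.
From mathcomp Require Import ring lra.

(* Write [T1], [T2] for the analysis operators of the two frames and [P1], [P2], [P] for the Gram
   projections of the two frames and of their sum, so that [P] projects onto [ran T1 + ran T2]; the
   superframe inequality says that this sum is direct and topological.

   Non-expansiveness: the relaxation [y <- y - (P1 y + P2 y)/2] fixes [ker P] and contracts [ran P] by
   a uniform factor, so starting from [delta_i] it converges to [(1 - P) delta_i] uniformly in [i];
   since balls have uniformly bounded cardinality, [P1] and [P2] map uniformly localised families to
   uniformly localised families, and uniform limits preserve this.

   Additivity: [P = E1 + E2], where [E1] is the oblique projection onto [ran T1] that kills [ran T2] and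
   the complement of [ran P] (and symmetrically for [E2]). As [P1 E1 = E1] and [E1 P1 = P1], the
   difference [E1 - P1] is the commutator of [P1] and [E1]. In its trace over [In n] the
   pairs inside [In n] cancel; the pairs leaving [In n] are controlled by the localisation of [P1]
   except near the boundary, which has vanishing density. Concretely [E1 delta_i = T1 u_i], where [u_i] is
   the first component of the canonical dual of the direct sum frame, so no operator theory on
   [l2] is needed. *)

Set Implicit Arguments.
Unset Strict Implicit.
Unset Printing Implicit Defensive.

Import Order.TTheory GRing.Theory Num.Theory.
Import numFieldNormedType.Exports.
Local Open Scope ring_scope.
Local Open Scope classical_set_scope.

(** * Complex numbers *)

Section ComplexParts.
Variable R : realType.
Local Notation C := R[i].
Local Notation normc := (@ComplexField.Normc.normc R).
Local Notation Re := complex.Re.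
Local Notation Im := complex.Im.

Lemma ReD (x y : C) : Re (x + y) = Re x + Re y.
Proof. by case: x y => ? ? []. Qed.

Lemma ImD (x y : C) : Im (x + y) = Im x + Im y.
Proof. by case: x y => ? ? []. Qed.

Lemma ReN (x : C) : Re (- x) = - Re x.
Proof. by case: x. Qed.

Lemma ImN (x : C) : Im (- x) = - Im x.
Proof. by case: x. Qed.

Lemma ReM (x y : C) : Re (x * y) = Re x * Re y - Im x * Im y.
Proof. by case: x y => ? ? []. Qed.

Lemma ImM (x y : C) : Im (x * y) = Re x * Im y + Im x * Re y.
Proof. by case: x y => ? ? []. Qed.

Lemma ReJ (x : C) : Re (conjc x) = Re x.
Proof. by case: x. Qed.

Lemma ImJ (x : C) : Im (conjc x) = - Im x.
Proof. by case: x. Qed.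

Lemma ReR (t : R) : Re (t%:C)%C = t. Proof. by []. Qed.
Lemma ImR (t : R) : Im (t%:C)%C = 0. Proof. by []. Qed.

Lemma Rei : Re ('i)%C = 0 :> R. Proof. by []. Qed.
Lemma Imi : Im ('i)%C = 1 :> R. Proof. by []. Qed.
Lemma Re0 : Re 0 = 0 :> R. Proof. by []. Qed.
Lemma Im0 : Im 0 = 0 :> R. Proof. by []. Qed.

Definition ReImE := (Rei, Imi, Re0, Im0, ReD, ImD, ReN, ImN, ReM, ImM, ReJ, ImJ, ReR, ImR).

Lemma eqC (x y : C) : Re x = Re y -> Im x = Im y -> x = y.
Proof. by case: x y => ? ? [? ?] /= -> ->. Qed.

Lemma normc2E (x : C) : normc x ^+ 2 = Re x ^+ 2 + Im x ^+ 2.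
Proof. by case: x => a b /=; rewrite sqr_sqrtr // addr_ge0 // sqr_ge0. Qed.

Lemma normc_ge0 (x : C) : 0 <= normc x.
Proof. by case: x => a b /=; rewrite sqrtr_ge0. Qed.

Lemma normc2M (x y : C) : normc (x * y) ^+ 2 = normc x ^+ 2 * normc y ^+ 2.
Proof. by rewrite !normc2E !ReImE; ring. Qed.

Lemma normc2J (x : C) : normc (conjc x) ^+ 2 = normc x ^+ 2.
Proof. by rewrite !normc2E !ReImE; ring. Qed.

Lemma normc_real (t : R) : normc (t%:C)%C = `|t|.
Proof. by rewrite /= expr0n addr0 sqrtr_sqr. Qed.

Lemma mulcJ (x : C) : x * conjc x = ((normc x ^+ 2)%:C)%C.
Proof. by apply: eqC; rewrite !ReImE ?normc2E; ring. Qed.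

Lemma Re_sum (T : Type) (s : seq T) (F : T -> C) :
  Re (\sum_(i <- s) F i) = \sum_(i <- s) Re (F i).
Proof. by elim/big_rec2: _ => // i a b _ <-; rewrite ReD. Qed.

Lemma Im_sum (T : Type) (s : seq T) (F : T -> C) :
  Im (\sum_(i <- s) F i) = \sum_(i <- s) Im (F i).
Proof. by elim/big_rec2: _ => // i a b _ <-; rewrite ImD. Qed.

Lemma normc_lt_sq (z : C) (e : R) : 0 < e -> (normc z < e) = (normc z ^+ 2 < e ^+ 2).
Proof. by move=> e0; rewrite ltr_pXn2r // nnegrE ?normc_ge0 // ltW. Qed.

Lemma Re_le_normc (z : C) : `|Re z| <= normc z.
Proof.
suff: `|Re z| ^+ 2 <= normc z ^+ 2 by rewrite ler_pXn2r // nnegrE ?normc_ge0.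
by rewrite real_normK ?num_real // normc2E lerDl sqr_ge0.
Qed.

Lemma normc2D_le (x y : C) : normc (x + y) ^+ 2 <= 2 * normc x ^+ 2 + 2 * normc y ^+ 2.
Proof.
rewrite !normc2E !ReImE; have := sqr_ge0 (Re x - Re y).
by have := sqr_ge0 (Im x - Im y); rewrite !sqrrD !sqrrN; lra.
Qed.

(** The degenerate case [a = 0] matters because the forms below may vanish on nonzero vectors. *)
Lemma discriminant_le (a r c : R) :
  (forall t, 0 <= t ^+ 2 * a + 2 * t * r + c) -> r ^+ 2 <= a * c.
Proof.
move=> H; have c0 : 0 <= c by have := H 0; lra.
have [a0|a0] := eqVneq a 0.
  rewrite a0 in H *; have [->|r0] := eqVneq r 0; first by rewrite expr0n mul0r.
  (* At this [t] the affine polynomial takes the value [-1]. *)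
  have := H (- (c + 1) / (2 * r)); have -> : (- (c + 1) / (2 * r)) ^+ 2 * 0
    + 2 * (- (c + 1) / (2 * r)) * r + c = -1 by field.
  by lra.
have a_ge0 : 0 <= a.
  rewrite leNgt; apply/negP => a_lt0.
  (* If [a < 0] then [t >= 1], and the values at [t] and [-t] add up to
     [2 * (t * (a - c) + c) <= 2 * a < 0]. *)
  set t := 1 - c / a; have ta : t * a = a - c by rewrite /t mulrBl mul1r divfK.
  have t1 : 1 <= t by rewrite lerDl oppr_ge0 mulr_ge0_le0 // invr_le0 ltW.
  have := H t; have := H (- t); have : t ^+ 2 * a = t * (a - c) by rewrite -ta; ring.
  rewrite sqrrN; nra.
have a_gt0 : 0 < a by rewrite lt_neqAle eq_sym a0.
have := H (- r / a).
have -> : (- r / a) ^+ 2 * a + 2 * (- r / a) * r + c = (a * c - r ^+ 2) / a by field.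
by rewrite pmulr_lge0 ?invr_gt0 // subr_ge0.
Qed.

End ComplexParts.

(** * Semi-inner products and the Riesz lemma *)

Section SemiInner.
Variables (R : realType) (V : lmodType R[i]).
Local Notation C := R[i].
Local Notation normc := (@ComplexField.Normc.normc R).
Local Notation Re := complex.Re.
Local Notation Im := complex.Im.

Record subspace (K : V -> Prop) : Prop := Subspace {
  subspace0 : K 0;
  subspaceP : forall (a : C) x y, K x -> K y -> K (a *: x + y) }.

(** The laws are relative to [K] since [dot] is meaningful only on square summable families.
    Positivity is semi-definite so that forms pulled back along an analysis operator qualify. *)
Record semi_inner (K : V -> Prop) (b : V -> V -> C) : Prop := SemiInner {
  semi_sub : subspace K;
  semi_lin : forall (a : C) x y z, K x -> K y -> K z ->
    b (a *: x + y) z = a * b x z + b y z;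
  semi_herm : forall x y, K x -> K y -> b y x = conjc (b x y);
  semi_pos : forall x, K x -> 0 <= nsq b x }.

Section Theory.
Variables (K : V -> Prop) (b : V -> V -> C).
Hypothesis S : semi_inner K b.
Let K0 := subspace0 (semi_sub S).
Let KP := subspaceP (semi_sub S).

Lemma semi_closedZ (a : C) x : K x -> K (a *: x).
Proof. by move=> Kx; rewrite -[_ *: _]addr0; apply: KP. Qed.

Lemma semi_closedD x y : K x -> K y -> K (x + y).
Proof. by move=> Kx Ky; rewrite -[x]scale1r; apply: KP. Qed.

Lemma semi_closedB x y : K x -> K y -> K (x - y).
Proof. by move=> Kx Ky; rewrite addrC -scaleN1r; apply: KP. Qed.

Lemma semi_linr (a : C) x y z : K x -> K y -> K z ->
  b z (a *: x + y) = conjc a * b z x + b z y.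
Proof.
move=> Kx Ky Kz; rewrite (semi_herm S (KP a Kx Ky) Kz) (semi_lin S) //.
by rewrite rmorphD rmorphM /= -!(semi_herm S).
Qed.

Lemma semiDr x y z : K x -> K y -> K z -> b z (x + y) = b z x + b z y.
Proof. by move=> Kx Ky Kz; rewrite -{1}[x]scale1r semi_linr // conjc1 mul1r. Qed.

Lemma semi0l z : K z -> b 0 z = 0.
Proof.
by move=> Kz; have := semi_lin S 1 K0 K0 Kz; rewrite scaler0 addr0 mul1r => /(canLR (addrK _));
  rewrite subrr.
Qed.

Lemma semi0r z : K z -> b z 0 = 0.
Proof. by move=> Kz; rewrite (semi_herm S) // semi0l // conjc0. Qed.

Lemma semiZl (a : C) x z : K x -> K z -> b (a *: x) z = a * b x z.
Proof. by move=> Kx Kz; rewrite -[_ *: _]addr0 (semi_lin S) // semi0l // addr0. Qed.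

Lemma semiZr (a : C) x z : K x -> K z -> b z (a *: x) = conjc a * b z x.
Proof. by move=> Kx Kz; rewrite -[_ *: _]addr0 semi_linr // semi0r // addr0. Qed.

Lemma semiBl x y z : K x -> K y -> K z -> b (x - y) z = b x z - b y z.
Proof. by move=> Kx Ky Kz; rewrite addrC -scaleN1r (semi_lin S) // mulN1r addrC. Qed.

Lemma semiBr x y z : K x -> K y -> K z -> b z (x - y) = b z x - b z y.
Proof.
by move=> Kx Ky Kz; rewrite addrC -scaleN1r semi_linr // rmorphN1 mulN1r addrC.
Qed.

Lemma semi_diag x : K x -> b x x = ((nsq b x)%:C)%C.
Proof.
move=> Kx; apply: eqC; rewrite !ReImE //.
by have /(congr1 (@complex.Im R)) := semi_herm S Kx Kx; rewrite ImJ; lra.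
Qed.

Lemma semi_ReC x y : K x -> K y -> Re (b x y) = Re (b y x).
Proof. by move=> Kx Ky; rewrite (semi_herm S Ky Kx) ReJ. Qed.

Lemma nsq_comb (t : R) x y : K x -> K y ->
  nsq b ((t%:C)%C *: x + y) = t ^+ 2 * nsq b x + 2 * t * Re (b x y) + nsq b y.
Proof.
move=> Kx Ky; rewrite /nsq (semi_lin S) //; last exact: KP.
rewrite !semi_linr // !ReImE (semi_ReC Ky Kx); ring.
Qed.

Lemma nsqD x y : K x -> K y -> nsq b (x + y) = nsq b x + 2 * Re (b x y) + nsq b y.
Proof.
by move=> Kx Ky; have := nsq_comb 1 Kx Ky; rewrite scale1r => ->; ring.
Qed.

Lemma nsqB x y : K x -> K y -> nsq b (x - y) = nsq b x - 2 * Re (b x y) + nsq b y.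
Proof.
move=> Kx Ky; have := nsq_comb (- 1) Ky Kx; rewrite rmorphN1 scaleN1r addrC => ->.
by rewrite (semi_ReC Ky Kx); ring.
Qed.

Lemma nsqZ (a : C) x : K x -> nsq b (a *: x) = normc a ^+ 2 * nsq b x.
Proof.
move=> Kx; rewrite {1}/nsq semiZl ?semiZr //; last exact: semi_closedZ.
by rewrite mulrA mulcJ !ReImE mul0r subr0.
Qed.

Lemma nsq0 : nsq b 0 = 0.
Proof. by rewrite /nsq semi0l. Qed.

Lemma nsqD_le x y : K x -> K y -> nsq b (x + y) <= 2 * nsq b x + 2 * nsq b y.
Proof.
by move=> Kx Ky; have := semi_pos S (semi_closedB Kx Ky); rewrite nsqB // nsqD //; lra.
Qed.

Lemma nsqB_le x y : K x -> K y -> nsq b (x - y) <= 2 * nsq b x + 2 * nsq b y.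
Proof.
by move=> Kx Ky; have := semi_pos S (semi_closedD Kx Ky); rewrite nsqB // nsqD //; lra.
Qed.

Lemma nsqBC x y : K x -> K y -> nsq b (x - y) = nsq b (y - x).
Proof. by move=> Kx Ky; rewrite !nsqB // (semi_ReC Ky Kx); ring. Qed.

Lemma cauchy_schwarz_Re x y : K x -> K y -> Re (b x y) ^+ 2 <= nsq b x * nsq b y.
Proof.
move=> Kx Ky; apply: discriminant_le => t; rewrite -nsq_comb //.
by apply: (semi_pos S); apply: KP.
Qed.

Lemma cauchy_schwarz x y : K x -> K y -> normc (b x y) ^+ 2 <= nsq b x * nsq b y.
Proof.
move=> Kx Ky; set z := b x y.
have := cauchy_schwarz_Re (semi_closedZ (conjc z) Kx) Ky.
rewrite semiZl // -/z mulrC mulcJ ReR nsqZ // normc2J.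
have := sqr_ge0 (normc z); move: (normc z ^+ 2) => w.
have := semi_pos S Kx; have := semi_pos S Ky; move: (nsq b x) (nsq b y) => p q q0 p0.
rewrite le_eqVlt => /predU1P[<-|w0]; first by rewrite mulr_ge0.
by rewrite expr2 -mulrA ler_pM2l.
Qed.

(** Weighted Young inequality, from the squared norm of [y - s x] divided by [s]. *)
Lemma Re_semi_le x y (s : R) : 0 < s -> K x -> K y ->
  2 * Re (b x y) <= s * nsq b x + s^-1 * nsq b y.
Proof.
move=> s0 Kx Ky; have := semi_pos S (KP ((- s)%:C)%C Kx Ky).
rewrite nsq_comb // -(pmulr_rge0 _ (_ : 0 < s^-1)) ?invr_gt0 //.
have -> : s^-1 * ((- s) ^+ 2 * nsq b x + 2 * - s * Re (b x y) + nsq b y)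
  = s * nsq b x - 2 * Re (b x y) + s^-1 * nsq b y by field; rewrite gt_eqF.
by lra.
Qed.

(** The limit is required to lie in [K]; squared norms avoid square roots. *)
Definition complete_for : Prop := forall u : nat -> V, (forall n, K (u n)) ->
  (forall e : R, 0 < e -> exists N, forall m n, (N <= m)%N -> (N <= n)%N ->
     nsq b (u m - u n) < e) ->
  exists2 v, K v & forall e : R, 0 < e -> exists N, forall n, (N <= n)%N ->
     nsq b (u n - v) < e.

Lemma inv_lt_eventually (e : R) : 0 < e -> exists N, forall n, (N <= n)%N -> (n.+1%:R : R)^-1 < e.
Proof.
move=> e0; exists (Num.truncn e^-1) => n Nn.
rewrite -[e]invrK ltf_pV2 ?posrE ?invr_gt0 ?ltr0Sn //.
apply: (lt_le_trans (real_truncnS_gt _)); first by rewrite num_real.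
by rewrite ler_nat.
Qed.

(* Minimise [nsq b h - 2 Re (phi h)] over [K]: minimising sequences are Cauchy by the
   parallelogram law. *)
Lemma riesz (phi : V -> C) (M : R) : complete_for ->
  (forall a x y, K x -> K y -> phi (a *: x + y) = conjc a * phi x + phi y) ->
  (forall h, K h -> normc (phi h) ^+ 2 <= M * nsq b h) ->
  exists2 g, K g & forall h, K h -> b g h = phi h.
Proof.
move=> cpl phiL phiM.
pose J h := nsq b h - 2 * Re (phi h).
have ReP h : K h -> Re (phi h) ^+ 2 <= M * nsq b h.
  by move=> Kh; apply: le_trans (phiM h Kh); rewrite normc2E lerDl sqr_ge0.
(* With [q] the squared norm, [r] the real part and [m] the absolute value of [M], a value
   [q - 2 r < - m] would give [(q + m)^2 < 4 r^2 <= 4 m q], against [0 <= (q - m)^2]. *)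
have Jbd h : K h -> - `|M| <= J h.
  move=> Kh; have := ReP h Kh; have := semi_pos S Kh; rewrite /J.
  have := ler_norm M; have := normr_ge0 M.
  move: (`|M|) (nsq b h) (Re _) => m q r m0 Mm q0 rM.
  rewrite leNgt; apply/negP => lt.
  have h1 : q + m < 2 * r by lra.
  have h2 : (q + m) ^+ 2 < (2 * r) ^+ 2 by rewrite ltr_pXn2r ?nnegrE //; lra.
  have h3 : M * q <= m * q by rewrite ler_wpM2r.
  have := sqr_ge0 (q - m); nra.
have Jcomb t h u : K h -> K u ->
    J ((t%:C)%C *: h + u) = t ^+ 2 * nsq b h + 2 * t * (Re (b h u) - Re (phi h)) + J u.
  by move=> Kh Ku; rewrite /J nsq_comb // phiL // !ReImE; ring.
pose A := [set J h | h in [set h | K h]].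
have Ainf : has_inf A.
  split; first by exists (J 0), 0.
  by exists (- `|M|) => _ [h Kh <-]; exact: Jbd.
pose mu := inf A.
have muJ h : K h -> mu <= J h by move=> Kh; apply: (ge_inf Ainf.2); exists h.
have /choice [u uP] n : exists u, K u /\ J u < mu + (n.+1%:R)^-1.
  have n0 : 0 < (n.+1%:R)^-1 :> R by rewrite invr_gt0 ltr0Sn.
  by have [_ [h Kh <-] lt] := inf_adherent n0 Ainf; exists h.
have Ku n := (uP n).1.
have [g Kg gP] : exists2 v, K v & forall e : R, 0 < e -> exists N, forall n, (N <= n)%N ->
     nsq b (u n - v) < e.
  apply: cpl => // e e0; have e4 : 0 < e / 4 by lra.
  have [N NP] := inv_lt_eventually e4; exists N => m n Nm Nn.
  have Kd := semi_closedB (Ku m) (Ku n).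
  (* [J] is at least [mu] at the midpoint of [u m] and [u n], which bounds [nsq b (u m - u n)] by
     [2 / (m + 1) + 2 / (n + 1)]. *)
  have := muJ _ (KP (((2^-1 : R)%:C)%C) Kd (Ku n)); rewrite Jcomb //.
  have := Jcomb 1 _ _ Kd (Ku n); rewrite scale1r subrK => Jm.
  have := (uP m).2; have := (uP n).2; have := NP m Nm; have := NP n Nn.
  move: Jm; move: (m.+1%:R^-1) (n.+1%:R^-1) (J (u m)) (J (u n)) (nsq b _) (Re (b _ _) - _).
  by move=> em en Jm Jn D r; rewrite !expr2 mulfV //; lra.
exists g => //.
(* First variation at the near-minimiser [u n]: moving along [h] lowers [J] by at most
   [1 / (n + 1)], so a discriminant is small; then [u n] tends to [g]. *)
have ReE h : K h -> Re (b h g) = Re (phi h).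
  move=> Kh; have qh := semi_pos S Kh.
  suff /eqP : (Re (b h g) - Re (phi h)) ^+ 2 = 0 by rewrite sqrf_eq0 subr_eq0 => /eqP.
  suff small (e : R) : 0 < e -> (Re (b h g) - Re (phi h)) ^+ 2 <= e.
    by apply/eqP; rewrite eq_le sqr_ge0 andbT; apply/ler_addgt0Pl => e e0; rewrite addr0 small.
  move=> e0; have e1 : 0 < e / (4 * (nsq b h + 1)) by rewrite divr_gt0 //; lra.
  have [N1 N1P] := inv_lt_eventually e1; have [N2 N2P] := gP _ e1.
  pose n := maxn N1 N2; have := N1P n (leq_maxl _ _); have := N2P n (leq_maxr _ _).
  set dl := e / _ in e1 N1P N2P *; set en := (_^-1); set qn := nsq b _ => lt1 lt2.
  have r1 : (Re (b h (u n)) - Re (phi h)) ^+ 2 <= nsq b h * en.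
    apply: discriminant_le => t; have := muJ _ (KP (t%:C)%C Kh (Ku n)).
    by rewrite Jcomb //; have := (uP n).2; rewrite -/en; lra.
  have r2 : Re (b h (u n - g)) ^+ 2 <= nsq b h * qn.
    by apply: cauchy_schwarz_Re => //; apply: semi_closedB.
  have := r2; rewrite semiBr // ReD ReN => {}r2.
  have edl : e = 4 * (nsq b h + 1) * dl by rewrite /dl mulrC divfK //; lra.
  have h1 : nsq b h * en <= nsq b h * dl by rewrite ler_wpM2l // ltW.
  have h2 : nsq b h * qn <= nsq b h * dl by rewrite ler_wpM2l // ltW.
  move: r1 r2; set r := Re (b h (u n)); set s := Re (b h g); set p := Re (phi h) => r1 r2.
  have key : (s - p) ^+ 2 = 2 * (r - p) ^+ 2 + 2 * (r - s) ^+ 2 - ((r - p) + (r - s)) ^+ 2.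
    by ring.
  have {}edl : e = 4 * (nsq b h * dl) + 4 * dl by rewrite edl; ring.
  by have := sqr_ge0 ((r - p) + (r - s)); rewrite key edl; lra.
move=> h Kh; have e1 := ReE h Kh; apply: eqC; first by rewrite -e1 semi_ReC.
(* Imaginary parts follow by testing with [h] times the imaginary unit. *)
have := ReE _ (semi_closedZ ('i)%C Kh); rewrite semi_ReC //; last exact: semi_closedZ.
rewrite semiZr // -[_ *: h]addr0 phiL // !ReImE.
have : phi 0 = 0.
  have := phiL 1 0 0 K0 K0; rewrite scaler0 addr0 conjc1 mul1r => /(canLR (addrK _)).
  by rewrite subrr.
by move=> ->; rewrite !ReImE; lra.
Qed.

End Theory.
End SemiInner.

(** * Square summable families *)

Section FsetSums.
Variables (R : realType) (I : choiceType).

Lemma sum_fsubset (M : nmodType) (S T : {fset I}) (F : I -> M) : (S `<=` T)%fset ->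
  \sum_(i <- T) F i = \sum_(i <- S) F i + \sum_(i <- (T `\` S)%fset) F i.
Proof.
move=> ST; rewrite (big_fsetID _ (mem S)) /=; congr (_ + _).
  apply: eq_fbigl => i; rewrite !inE /=.
  by case iS: (i \in S); rewrite ?andbT ?andbF // (fsubsetP ST).
by apply: eq_fbigl => i; rewrite !inE /= andbC.
Qed.

Lemma ler_sum_fsubset (S T : {fset I}) (F : I -> R) : (S `<=` T)%fset ->
  (forall i, 0 <= F i) -> \sum_(i <- S) F i <= \sum_(i <- T) F i.
Proof. by move=> ST F0; rewrite (sum_fsubset _ ST) lerDl sumr_ge0. Qed.

(** Turns extended sums into bounds on finite sums, so that later estimates stay in [R]. *)
Lemma esum_leP (D : set I) (a : I -> R) (b : R) : (forall i, 0 <= a i) ->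
  (\esum_(i in D) (a i)%:E <= b%:E)%E <->
  (forall S : {fset I}, (forall i, i \in S -> D i) -> \sum_(i <- S) a i <= b).
Proof.
move=> a0; split=> [H S SD|H].
  rewrite -lee_fin; apply: le_trans H; apply: esum_ge; exists [set` S].
    by split=> // i /= /SD.
  by rewrite -sumEFin (@fsbig_finite _ _ _ _ [set` S]) ?set_fsetK.
apply: ge_ereal_sup => _ [X [finX XD] <-].
rewrite fsbig_finite // sumEFin lee_fin; apply: H => i.
by rewrite in_fset_set // inE => /XD.
Qed.

End FsetSums.

Section SquareSummable.
Variables (R : realType) (I : countType) (In : nat -> {fset I}).
Hypothesis exh : nested_exhaustion In.
Local Notation C := R[i].
Local Notation normc := (@ComplexField.Normc.normc R).
Local Notation Re := complex.Re.
Local Notation Im := complex.Im.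
Local Notation psum := (psum In).
Local Notation l2 := (@l2 R I).

Lemma In_mono m n : (m <= n)%N -> (In m `<=` In n)%fset.
Proof.
elim: n => [|n IH]; first by rewrite leqn0 => /eqP ->.
rewrite leq_eqVlt ltnS => /predU1P[-> //|/IH /fsubset_trans]; apply; exact: exh.1.
Qed.

Lemma fset_sub_In (S : {fset I}) : exists n, (S `<=` In n)%fset.
Proof.
have : exists n, forall i, i \in enum_fset S -> i \in In n.
  elim: (enum_fset S) => [|i s [n nP]]; first by exists 0%N.
  have [m mP] := exh.2 i; exists (maxn m n) => j; rewrite inE => /predU1P[->|/nP].
    by apply: (fsubsetP (In_mono (leq_maxl _ _))).
  by apply: (fsubsetP (In_mono (leq_maxr _ _))).
by move=> [n nP]; exists n; apply/fsubsetP.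
Qed.

Lemma cvgCP (u : nat -> C) (l : C) : cvgC u l <->
  (fun n => Re (u n)) @ \oo --> Re l /\ (fun n => Im (u n)) @ \oo --> Im l.
Proof.
split=> [H|[H1 H2] e e0].
  split; apply/cvgrPdist_lt => e e0; have [N NP] := H e e0; exists N => // n /= /NP;
    apply: le_lt_trans; rewrite distrC.
    by rewrite -ReN -ReD Re_le_normc.
  have -> : Im (u n) - Im l = Re ((u n - l) * - 'i%C) by rewrite !ReImE; ring.
  apply: le_trans (Re_le_normc _) _; rewrite ComplexField.Normc.normcM normcN.
  by rewrite /= expr0n expr1n add0r sqrtr1 mulr1.
have e20 : 0 < e / 2 by rewrite divr_gt0.
move: H1 H2 => /cvgrPdist_lt /(_ _ e20) [N1 _ N1P] /cvgrPdist_lt /(_ _ e20) [N2 _ N2P].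
exists (maxn N1 N2) => n; rewrite geq_max => /andP[/N1P /= h1 /N2P /= h2].
have sq (z : R) : `|z| < e / 2 -> z ^+ 2 < (e / 2) ^+ 2.
  move=> h; rewrite -[z ^+ 2]real_normK ?num_real //.
  by rewrite ltr_pXn2r // nnegrE // ltW.
by rewrite normc_lt_sq // normc2E !ReImE; have := sq _ h1; have := sq _ h2; nra.
Qed.

Lemma cvgn_unique (u : nat -> R) (l l' : R) : u @ \oo --> l -> u @ \oo --> l' -> l = l'.
Proof. by move=> h1 h2; exact: (cvg_unique (@norm_hausdorff _ _) h1 h2). Qed.

Lemma cvgC_unique (u : nat -> C) l l' : cvgC u l -> cvgC u l' -> l = l'.
Proof.
by move=> /cvgCP[h1 h2] /cvgCP[h3 h4]; apply: eqC; [exact: cvgn_unique h1 h3 | exact: cvgn_unique h2 h4].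
Qed.

Lemma cvgC_lin (a : C) (u v : nat -> C) l l' :
  cvgC u l -> cvgC v l' -> cvgC (fun n => a * u n + v n) (a * l + l').
Proof.
move=> /cvgCP[h1 h2] /cvgCP[h3 h4]; apply/cvgCP; split.
  under eq_fun do rewrite !ReImE; rewrite !ReImE.
  by apply: cvgD => //; apply: cvgB; apply: cvgMl_tmp.
under eq_fun do rewrite !ReImE; rewrite !ReImE.
by apply: cvgD => //; apply: cvgD; apply: cvgMl_tmp.
Qed.

Lemma cvgC_conj (u : nat -> C) l : cvgC u l -> cvgC (fun n => conjc (u n)) (conjc l).
Proof.
move=> /cvgCP[h1 h2]; apply/cvgCP; split.
  by under eq_fun do rewrite !ReImE; rewrite !ReImE.
by under eq_fun do rewrite !ReImE; rewrite !ReImE; apply: cvgN.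
Qed.

Lemma cvgC_eventually (u : nat -> C) l N : (forall n, (N <= n)%N -> u n = l) -> cvgC u l.
Proof.
by move=> H e e0; exists N => n /H ->; rewrite subrr ComplexField.Normc.normc0.
Qed.

Lemma psum_lin (a : C) (x y : I -> C) n :
  psum (fun i => a * x i + y i) n = a * psum x n + psum y n.
Proof. by rewrite /psum big_split /= mulr_sumr. Qed.

Lemma nonneg_sum_cvg (a : I -> R) (b : R) : (forall i, 0 <= a i) ->
  (forall n, \sum_(i <- In n) a i <= b) ->
  exists2 l : R, (fun n => \sum_(i <- In n) a i) @ \oo --> l &
    l <= b /\ forall S : {fset I}, \sum_(i <- S) a i <= l.
Proof.
move=> a0 ab; set u := (fun n => \sum_(i <- In n) a i).
have ndu : nondecreasing_seq u by move=> m n mn; apply: ler_sum_fsubset => //; exact: In_mono.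
have ubu : has_ubound (range u) by exists b => _ [n _ <-]; exact: ab.
have cu := nondecreasing_cvgn ndu ubu; exists (sup (range u)) => //; split.
  apply: ge_sup; first by exists (u 0%N), 0%N.
  by move=> _ [n _ <-]; exact: ab.
move=> S; have [n Sn] := fset_sub_In S.
apply: (le_trans (ler_sum_fsubset Sn a0)).
by apply: (ub_le_sup ubu); exists n.
Qed.

Lemma l2P (x : I -> C) : l2 x <->
  exists b : R, forall S : {fset I}, \sum_(i <- S) normc (x i) ^+ 2 <= b.
Proof.
have x0 i : 0 <= normc (x i) ^+ 2 by exact: sqr_ge0.
split=> [|[b H]]; rewrite /l2.
  have : (0 <= \esum_(k in [set: I]) (normc (x k) ^+ 2)%:E)%E.
    by apply: esum_ge0 => i _; rewrite lee_fin.
  case E: (\esum_(k in _) _)%E => [b| |] // _ _; exists b => S.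
  by apply: (esum_leP setT b x0).1 => //; rewrite E.
apply: (@le_lt_trans _ _ b%:E); last exact: ltry.
by apply/esum_leP => // S _.
Qed.

(* Meaningful for square summable [x] and [y] only. *)
Definition dot (x y : I -> C) : C :=
  epsilon (inhabits 0) (cvgC (psum (fun i => x i * conjc (y i)))).

Lemma l2_sub : subspace l2.
Proof.
split; first by apply/l2P; exists 0 => S; rewrite big1 // => i _;
  rewrite ComplexField.Normc.normc0 expr0n.
move=> a x y /l2P[b bP] /l2P[c cP]; apply/l2P.
exists (2 * normc a ^+ 2 * b + 2 * c) => S.
apply: (@le_trans _ _ (2 * normc a ^+ 2 * \sum_(i <- S) normc (x i) ^+ 2
   + 2 * \sum_(i <- S) normc (y i) ^+ 2)).
  rewrite !mulr_sumr -big_split /=; apply: ler_sum => i _; rewrite -mulrA -normc2M.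
  change ((a *: x + y) i) with (a * x i + y i); rewrite !normc2E ReD ImD.
  have := sqr_ge0 (Re (a * x i) - Re (y i)); have := sqr_ge0 (Im (a * x i) - Im (y i)).
  by rewrite !sqrrD !sqrrN; lra.
by apply: lerD; rewrite ler_wpM2l // mulr_ge0 // sqr_ge0.
Qed.

Lemma l2_sum_cvg (x : I -> C) : l2 x ->
  exists l : R, (fun n => \sum_(i <- In n) normc (x i) ^+ 2) @ \oo --> l.
Proof.
move=> /l2P[b bP]; have [|//|l cl _] := @nonneg_sum_cvg (fun i => normc (x i) ^+ 2) b.
  by move=> i; exact: sqr_ge0.
by exists l.
Qed.

(** Polarisation: partial sums of [Re (x conj z)] are combinations of partial sums of squared norms,
    which converge by monotonicity. *)
Lemma dot_cvg (x y : I -> C) : l2 x -> l2 y ->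
  cvgC (psum (fun i => x i * conjc (y i))) (dot x y).
Proof.
move=> lx ly; apply: epsilon_spec.
have [p cp] := l2_sum_cvg lx; have [q cq] := l2_sum_cvg ly.
have pol z : l2 z -> exists l : R, (fun n => \sum_(i <- In n) Re (x i * conjc (z i))) @ \oo --> l.
  move=> lz; have [r cr] := l2_sum_cvg lz.
  have [s cs] := l2_sum_cvg (subspaceP l2_sub 1 lx lz).
  exists (2^-1 * (s - p - r)).
  have -> : (fun n => \sum_(i <- In n) Re (x i * conjc (z i))) =
    (fun n => 2^-1 * (\sum_(i <- In n) normc ((1 *: x + z) i) ^+ 2
       - \sum_(i <- In n) normc (x i) ^+ 2 - \sum_(i <- In n) normc (z i) ^+ 2)).
    apply/funext => n; rewrite -!sumrB mulr_sumr; apply: eq_bigr => i _.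
    change ((1 *: x + z) i) with (1 * x i + z i); rewrite mul1r !normc2E !ReImE.
    by field.
  by apply: cvgMl_tmp; apply: cvgB => //; apply: cvgB.
have [l1 c1] := pol _ ly.
(* [Im (x conj y) = Re (x conj (i y))], so the imaginary part is the same argument with [i y]. *)
have liy : l2 (('i)%C *: y).
  by rewrite -[_ *: y]addr0; apply: (subspaceP l2_sub) => //; exact: subspace0 l2_sub.
have [l2 c2] := pol _ liy.
exists (Complex l1 l2); apply/cvgCP; split=> /=.
  by under eq_fun do rewrite Re_sum.
under eq_fun do rewrite Im_sum; apply: cvg_trans c2; apply: near_eq_cvg; near=> n.
apply: eq_bigr => i _; change (('i%C *: y) i) with ('i%C * y i); rewrite !ReImE; ring.
Unshelve. all: by end_near.
Qed.

Lemma dot_eq x y l : l2 x -> l2 y -> cvgC (psum (fun i => x i * conjc (y i))) l -> dot x y = l.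
Proof. by move=> lx ly; apply: cvgC_unique; exact: dot_cvg. Qed.

Lemma nsq_dot_cvg x : l2 x ->
  (fun n => \sum_(i <- In n) normc (x i) ^+ 2) @ \oo --> nsq dot x.
Proof.
move=> lx; have /cvgCP[+ _] := dot_cvg lx lx; apply: cvg_trans; apply: near_eq_cvg; near=> n.
by rewrite Re_sum; apply: eq_bigr => i _; rewrite mulcJ ReR.
Unshelve. all: by end_near.
Qed.

Lemma nsq_dot_ge x (S : {fset I}) : l2 x -> \sum_(i <- S) normc (x i) ^+ 2 <= nsq dot x.
Proof.
move=> lx; have /l2P[b bP] := lx.
have [|//|l cl [_ /(_ S)]] := @nonneg_sum_cvg (fun i => normc (x i) ^+ 2) b.
  by move=> i; exact: sqr_ge0.
by rewrite (cvgn_unique cl (nsq_dot_cvg lx)).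
Qed.

Lemma nsq_dot_le x b : (forall S : {fset I}, \sum_(i <- S) normc (x i) ^+ 2 <= b) ->
  nsq dot x <= b.
Proof.
move=> bP; have lx : l2 x by apply/l2P; exists b.
have [|//|l cl [lb _]] := @nonneg_sum_cvg (fun i => normc (x i) ^+ 2) b.
  by move=> i; exact: sqr_ge0.
by rewrite -(cvgn_unique cl (nsq_dot_cvg lx)).
Qed.

Lemma nsq_dot_esum x : l2 x ->
  (\esum_(k in [set: I]) (normc (x k) ^+ 2)%:E)%E = (nsq dot x)%:E.
Proof.
move=> lx; have x0 i : 0 <= normc (x i) ^+ 2 by exact: sqr_ge0.
apply/eqP; rewrite eq_le; apply/andP; split.
  by apply/esum_leP => // S _; exact: nsq_dot_ge.
have : (0 <= \esum_(k in [set: I]) (normc (x k) ^+ 2)%:E)%E.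
  by apply: esum_ge0 => i _; rewrite lee_fin.
move: (lx); rewrite /l2; case E: (\esum_(k in _) _)%E => [b| |] // _ _.
rewrite lee_fin; apply: nsq_dot_le => S.
by apply: (esum_leP setT b x0).1 => //; rewrite E.
Qed.

Lemma normc_coord_le x i : l2 x -> normc (x i) ^+ 2 <= nsq dot x.
Proof. by move=> lx; have := nsq_dot_ge [fset i]%fset lx; rewrite big_seq_fset1. Qed.

Lemma dot_semi : semi_inner l2 dot.
Proof.
split; first exact: l2_sub.
- move=> a x y z lx ly lz; apply: dot_eq => //; first exact: (subspaceP l2_sub).
  have := cvgC_lin a (dot_cvg lx lz) (dot_cvg ly lz); congr cvgC; apply/funext => n.
  rewrite -psum_lin; apply: eq_bigr => i _.
  by change ((a *: x + y) i) with (a * x i + y i); rewrite mulrDl mulrA.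
- move=> x y lx ly; apply: dot_eq => //.
  have := cvgC_conj (dot_cvg lx ly); congr cvgC; apply/funext => n.
  rewrite /psum rmorph_sum; apply: eq_bigr => i _ /=.
  by rewrite rmorphM /= conjcK mulrC.
- move=> x lx; apply: le_trans (nsq_dot_ge fset0 lx).
  by rewrite sumr_ge0 // => i _; exact: sqr_ge0.
Qed.

Lemma dot_fin_supp x y (S : {fset I}) : l2 x -> l2 y -> (forall i, i \notin S -> x i = 0) ->
  dot x y = \sum_(i <- S) x i * conjc (y i).
Proof.
move=> lx ly x0; apply: dot_eq => //; have [N SN] := fset_sub_In S.
apply: (@cvgC_eventually _ _ N) => n Nn; symmetry; apply: big_fset_incl.
  by apply: fsubset_trans SN _; exact: In_mono.
by move=> i _ /x0 ->; rewrite mul0r.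
Qed.

Lemma fin_supp_l2 (x : I -> C) (S : {fset I}) : (forall i, i \notin S -> x i = 0) -> l2 x.
Proof.
move=> x0; apply/l2P; exists (\sum_(i <- S) normc (x i) ^+ 2) => T.
have x20 i : 0 <= normc (x i) ^+ 2 by exact: sqr_ge0.
apply: (le_trans (ler_sum_fsubset (fsubsetUr S T) x20)).
rewrite (sum_fsubset _ (fsubsetUl S T)) gerDl big_seq big1 // => i.
by rewrite !inE => /andP[iS _]; rewrite x0 // ComplexField.Normc.normc0 expr0n.
Qed.

Lemma delta_l2 i : l2 (@delta R I i).
Proof.
by apply: (@fin_supp_l2 _ [fset i]%fset) => j; rewrite inE /delta => /negbTE ->.
Qed.

Lemma dot_delta i x : l2 x -> dot (@delta R I i) x = conjc (x i).
Proof.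
move=> lx; rewrite (@dot_fin_supp _ _ [fset i]%fset) //; last 2 first.
- exact: delta_l2.
- by move=> j; rewrite inE /delta => /negbTE ->.
by rewrite big_seq_fset1 /delta eqxx mul1r.
Qed.

End SquareSummable.

(** * Frames, canonical duals and Gram projections *)

Section Frames.
Variables (R : realType) (I : countType) (In : nat -> {fset I}).
Hypothesis exh : nested_exhaustion In.
Variables (V : lmodType R[i]) (ip : V -> V -> R[i]).
Local Notation C := R[i].
Local Notation normc := (@ComplexField.Normc.normc R).
Local Notation Re := complex.Re.
Local Notation dot := (dot In).
Local Notation l2 := (@l2 R I).

Definition everywhere (v : V) := True.

Record hilbert : Prop := Hilbert {
  hilbert_semi : semi_inner everywhere ip;
  hilbert_complete : complete_for everywhere ip }.

Lemma nrm_lt x (e : R) : 0 < e -> 0 <= nsq ip x -> (nrm ip x < e) = (nsq ip x < e ^+ 2).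
Proof.
move=> e0 x0; rewrite /nrm -{2}(sqr_sqrtr x0) ltr_pXn2r // nnegrE ?sqrtr_ge0 //.
exact: ltW.
Qed.

Lemma is_hilbertW : is_hilbert ip -> hilbert.
Proof.
move=> [lin herm pos cpl _].
have ip00 : nsq ip 0 = 0.
  have := lin 1 0 0 0; rewrite scaler0 addr0 mul1r => /(canLR (addrK _)).
  by rewrite subrr /nsq => <-.
have ge0 x : 0 <= nsq ip x.
  by have [->|/pos /ltW //] := eqVneq x 0; rewrite ip00.
split; first by split=> // *; exact: lin.
move=> u _ cauchy; have [|v vP] := cpl u.
  move=> e e0; have [N NP] := cauchy (e ^+ 2) (exprn_gt0 2 e0).
  by exists N => m n Nm Nn; rewrite nrm_lt // NP.
exists v => // e e0; have se0 : 0 < Num.sqrt e by rewrite sqrtr_gt0.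
have [N NP] := vP _ se0; exists N => n Nn; have := NP n Nn.
by rewrite nrm_lt // sqr_sqrtr // ltW.
Qed.

Hypothesis H : hilbert.
Let S := hilbert_semi H.

Definition closed_for (K : V -> Prop) := forall v,
  (forall e : R, 0 < e -> exists2 u, K u & nsq ip (v - u) < e) -> K v.

Lemma semi_inner_sub (K : V -> Prop) (b : V -> V -> C) : subspace K ->
  semi_inner everywhere b -> semi_inner K b.
Proof.
move=> sK Sb; split=> //.
- by move=> *; exact: (semi_lin Sb).
- by move=> *; exact: (semi_herm Sb).
- by move=> *; exact: (semi_pos Sb).
Qed.

Lemma closed_complete (K : V -> Prop) : subspace K -> closed_for K -> complete_for K ip.
Proof.
move=> sK cK u Ku cauchy; have [//|v _ vP] := hilbert_complete H _ cauchy.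
exists v => //; apply: cK => e e0; have [N NP] := vP e e0.
by exists (u N) => //; rewrite (nsqBC S) // NP.
Qed.

Section OneFrame.
Variable f : I -> V.

(** Lists in [in_cspan] may repeat indices; counting multiplicities brings two combinations to a
    common duplicate-free list. *)
Lemma sum_count (s T : seq I) (c : I -> C) : {subset s <= T} -> uniq T ->
  \sum_(j <- s) c j *: f j = \sum_(j <- T) (c j *+ count_mem j s) *: f j.
Proof.
move=> + uT; elim: s => [_|j s IH sub].
  by rewrite big_nil big1 // => i _; rewrite mulr0n scale0r.
rewrite big_cons IH => [|i si]; last by rewrite sub // inE si orbT.
under [RHS]eq_bigr do rewrite /= mulrnDr scalerDl; rewrite big_split /=; congr (_ + _).
rewrite (bigD1_seq j) //=; last by rewrite sub // inE eqxx.
by rewrite eqxx big1 ?addr0 // => i /negbTE ij; rewrite eq_sym ij mulr0n scale0r.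
Qed.

Lemma in_cspanP v : in_cspan ip f v <-> forall e : R, 0 < e -> exists (s : seq I) (c : I -> C),
    nsq ip (v - \sum_(j <- s) c j *: f j) < e.
Proof.
split=> h e e0.
  have se0 : 0 < Num.sqrt e by rewrite sqrtr_gt0.
  have [s [c sc]] := h _ se0; exists s, c.
  by move: sc; rewrite nrm_lt ?(semi_pos S) // sqr_sqrtr // ltW.
have [s [c sc]] := h (e ^+ 2) (exprn_gt0 2 e0); exists s, c.
by rewrite nrm_lt // (semi_pos S).
Qed.

Lemma cspan_sub : subspace (in_cspan ip f).
Proof.
split.
  by apply/in_cspanP => e e0; exists [::], (fun=> 0); rewrite big_nil subr0 (nsq0 S).
move=> a x y /in_cspanP hx /in_cspanP hy; apply/in_cspanP => e e0.
pose t := 2 * (normc a ^+ 2 + 1); have t0 : 0 < t by rewrite mulr_gt0 // ltr_pwDr // sqr_ge0.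
have [s1 [c1 h1]] := hx (e / t / 2) (divr_gt0 (divr_gt0 e0 t0) (ltr0n _ 2)).
have [s2 [c2 h2]] := hy (e / 4) (divr_gt0 e0 (ltr0n _ 4)).
pose T := undup (s1 ++ s2); pose c j := a * (c1 j *+ count_mem j s1) + c2 j *+ count_mem j s2.
exists T, c.
have -> : \sum_(j <- T) c j *: f j =
    a *: (\sum_(j <- s1) c1 j *: f j) + \sum_(j <- s2) c2 j *: f j.
  rewrite (@sum_count s1 T) ?undup_uniq //; last first.
    by move=> i si; rewrite mem_undup mem_cat si.
  rewrite (@sum_count s2 T) ?undup_uniq //; last first.
    by move=> i si; rewrite mem_undup mem_cat si orbT.
  rewrite scaler_sumr -big_split /=; apply: eq_bigr => j _.
  by rewrite scalerA -scalerDl.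
set p := \sum_(j <- s1) _ in h1 *; set q := \sum_(j <- s2) _ in h2 *.
have -> : a *: x + y - (a *: p + q) = a *: (x - p) + (y - q).
  by rewrite scalerBr opprD addrACA.
apply: (le_lt_trans (nsqD_le S _ _)) => //; rewrite (nsqZ S) //.
have g0 := semi_pos S (_ : everywhere (x - p)).
have n0 := sqr_ge0 (normc a).
have et : e / t / 2 * t = e / 2 by rewrite mulrAC divfK // gt_eqF.
have {}h1 : nsq ip (x - p) * t <= e / 2 by rewrite -et ler_wpM2r // ltW.
have := g0 Logic.I; move: h1 h2 n0; rewrite /t; nra.
Qed.

Lemma cspan_closed : closed_for (in_cspan ip f).
Proof.
move=> v h; apply/in_cspanP => e e0; have e4 : 0 < e / 4 by rewrite divr_gt0.
have [u /in_cspanP /(_ _ e4)[s [c sc]] uv] := h _ e4; exists s, c.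
rewrite -[v](subrK u) -addrA; apply: (le_lt_trans (nsqD_le S _ _)) => //; lra.
Qed.

Lemma cspan_gen i : in_cspan ip f (f i).
Proof.
apply/in_cspanP => e e0; exists [:: i], (fun=> 1).
by rewrite big_seq1 scale1r subrr (nsq0 S).
Qed.

(** The analysis operator. *)
Definition an (h : V) : I -> C := fun i => ip h (f i).

Lemma anP a x y : an (a *: x + y) = a *: an x + an y.
Proof. by apply/funext => i; rewrite /an (semi_lin S). Qed.

Lemma anB x y : an (x - y) = an x - an y.
Proof. by rewrite addrC -scaleN1r anP scaleN1r addrC. Qed.

(** [K] is a parameter because the direct sum frame is used on two subspaces: its closed span and
    the product of the component spans. *)
Record frame_bounds (K : V -> Prop) (A B : R) : Prop := FrameBounds {
  fb_sub : subspace K;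
  fb_closed : closed_for K;
  fb_gen : forall i, K (f i);
  fb_A : 0 < A;
  fb_B : 0 < B;
  fb_l2 : forall h, K h -> l2 (an h);
  fb_lower : forall h, K h -> A * nsq ip h <= nsq dot (an h);
  fb_upper : forall h, K h -> nsq dot (an h) <= B * nsq ip h }.

Lemma frame_forW K : subspace K -> closed_for K -> (forall i, K (f i)) ->
  frame_for ip f K -> exists A B, frame_bounds K A B.
Proof.
move=> sK cK gK [A [B [A0 B0 AB]]]; exists A, B.
have l2K h : K h -> l2 (an h).
  by move=> Kh; apply: le_lt_trans (AB h Kh).2 _; exact: ltry.
by split=> // h Kh; have := AB h Kh; rewrite (nsq_dot_esum exh (l2K h Kh)) !lee_fin => -[].
Qed.

Section Bounds.
Variables (K : V -> Prop) (A B : R).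
Hypothesis FB : frame_bounds K A B.
Let SK := semi_inner_sub (fb_sub FB) S.

Lemma orth_proj h : exists2 h', K h' & forall k, K k -> ip h' k = ip h k.
Proof.
apply: (riesz SK (phi := ip h) (M := nsq ip h)).
- by apply: closed_complete; [exact: (fb_sub FB) | exact: (fb_closed FB)].
- by move=> a x y _ _; rewrite (semi_linr S).
- by move=> k _; exact: (cauchy_schwarz S).
Qed.

(** Every [f i] lies in [K], so replacing [h] by its projection onto [K] leaves the analysis
    sequence unchanged. *)
Lemma an_proj h : exists2 h', K h' & an h = an h'.
Proof.
have [h' Kh' hP] := orth_proj h; exists h' => //; apply/funext => i.
by rewrite /an hP //; exact: (fb_gen FB).
Qed.

Lemma an_l2 h : l2 (an h).
Proof. by have [h' Kh' ->] := an_proj h; exact: (fb_l2 FB Kh'). Qed.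

(** The form of the frame operator. The frame bounds make it equivalent to [ip] on [K], hence
    complete there, and the Riesz lemma for it inverts the frame operator. *)
Definition aform g h := dot (an g) (an h).

Lemma aform_semi : semi_inner everywhere aform.
Proof.
have D := dot_semi R exh.
split=> //.
- by move=> a x y z _ _ _; rewrite /aform anP (semi_lin D) //; exact: an_l2.
- by move=> x y _ _; apply: (semi_herm D); exact: an_l2.
- by move=> x _; apply: (semi_pos D); exact: an_l2.
Qed.

Lemma aform_complete : complete_for K aform.
Proof.
move=> u Ku cauchy; have A0 := fb_A FB; have B0 := fb_B FB.
have KB x y : K x -> K y -> K (x - y) by exact: (semi_closedB SK).
have [//||v Kv vP] := closed_complete (fb_sub FB) (fb_closed FB) (u := u).
  move=> e e0; have [N NP] := cauchy (A * e) (mulr_gt0 A0 e0).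
  exists N => m n Nm Nn; rewrite -(ltr_pM2l A0).
  by apply: le_lt_trans (NP m n Nm Nn); apply: (fb_lower FB); exact: KB.
exists v => // e e0; have [N NP] := vP (e / B) (divr_gt0 e0 B0); exists N => n Nn.
apply: le_lt_trans (fb_upper FB (KB _ _ (Ku n) Kv)) _.
by rewrite mulrC -ltr_pdivlMr // NP.
Qed.

Lemma aform_riesz (phi : V -> C) (M : R) :
  (forall a x y, K x -> K y -> phi (a *: x + y) = conjc a * phi x + phi y) ->
  (forall h, K h -> normc (phi h) ^+ 2 <= M * nsq dot (an h)) ->
  exists2 w, K w & forall h, K h -> dot (an w) (an h) = phi h.
Proof.
by apply: (riesz (semi_inner_sub (fb_sub FB) aform_semi)); exact: aform_complete.
Qed.

(** Least squares: [an w] is the orthogonal projection of [x] onto the range of the analysis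
    operator. *)
Lemma normal_equation x : l2 x ->
  exists2 w, K w & forall h, dot (an w) (an h) = dot x (an h).
Proof.
move=> lx; have D := dot_semi R exh.
have [||w Kw wP] := aform_riesz (phi := fun h => dot x (an h)) (M := nsq dot x).
- by move=> a y z Ky Kz; rewrite anP (semi_linr D) //; exact: an_l2.
- by move=> h _; apply: (cauchy_schwarz D) => //; exact: an_l2.
by exists w => // h; have [h' Kh' ->] := an_proj h; exact: wP.
Qed.

Lemma frame_op_surj r : exists2 w, K w & forall h, K h -> dot (an w) (an h) = ip r h.
Proof.
apply: (aform_riesz (M := nsq ip r / A)).
- by move=> a x y _ _; rewrite (semi_linr S).
- move=> h Kh; apply: le_trans (cauchy_schwarz S _ _) _ => //.
  rewrite -mulrA ler_wpM2l ?(semi_pos S) // mulrC ler_pdivlMr ?(fb_A FB) //.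
  by rewrite mulrC; exact: (fb_lower FB Kh).
Qed.

End Bounds.

Section Dual.
Variables (A B : R).
Hypothesis FB : frame_bounds (in_cspan ip f) A B.
Let lan := an_l2 FB.
Let D := dot_semi R exh.
Local Notation cdual := (cdual In ip f).
Local Notation gram := (gram In ip f).

(** The normal equation for [delta i] is the defining equation of the canonical dual, since
    [delta i] pairs with [an h] to [ip (f i) h]; so the choice in [cdual] has a witness. *)
Lemma cdualP i : in_cspan ip f (cdual i) /\
  forall h, dot (an (cdual i)) (an h) = ip (f i) h.
Proof.
have aE g h : psum In (fun j => an g j * conjc (an h j)) = psum In (fun j => ip g (f j) * ip (f j) h).
  by apply/funext => n; apply: eq_bigr => j _; rewrite /an -(semi_herm S).
have : dual_pred In ip f i (cdual i).
  apply: epsilon_spec; have [w Kw wP] := normal_equation FB (delta_l2 R i).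
  exists w; split=> // h; have := dot_cvg exh (lan w) (lan h); rewrite wP (dot_delta exh) //.
  by rewrite -(semi_herm S) // aE.
move=> [Kg gP]; split=> // h; apply: (dot_eq exh) => //; rewrite aE; exact: gP.
Qed.

Lemma gram_predP i : gram_pred In ip f i (an (cdual i)).
Proof.
split=> //.
  move=> e e0; exists (cdual i); rewrite esum1 // => k _.
  by rewrite /an subrr ComplexField.Normc.normc0 expr0n.
move=> h; have ld := delta_l2 R i.
have lx : l2 (delta R i - an (cdual i)) by apply: (semi_closedB D).
have := dot_cvg exh lx (lan h); rewrite (semiBl D) // (cdualP i).2 (dot_delta exh) //.
by rewrite -(semi_herm S) // subrr.
Qed.

(** [x - an g] is orthogonal to the range of the analysis operator, while [x] lies in the closure of
    that range; by Pythagoras no [an h] is closer to [x] than [an g]. *)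
Lemma gram_pred_unique i x : gram_pred In ip f i x -> x = an (cdual i).
Proof.
move=> [lx apx orth]; have [_ gP] := cdualP i; set g := cdual i in gP *.
have ld := delta_l2 R i; pose y := x - an g.
have ly : l2 y by apply: (semi_closedB D).
have yo h : dot y (an h) = 0.
  rewrite (semiBl D) // gP.
  have := dot_eq exh (semi_closedB D ld lx) (lan h) (orth h).
  rewrite (semiBl D) // (dot_delta exh) // -(semi_herm S) // => /eqP.
  by rewrite subr_eq0 => /eqP ->; rewrite subrr.
have y0 : nsq dot y = 0.
  apply/eqP; rewrite eq_le (semi_pos D) // andbT.
  suff small (e : R) : 0 < e -> nsq dot y <= e.
    by apply/ler_addgt0Pl => e e0; rewrite addr0 small.
  move=> e0; have [h hP] := apx e e0.
  have lz : l2 (x - an h) by exact: (semi_closedB D lx (lan h)).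
  have {}hP : nsq dot (x - an h) < e by rewrite -lte_fin -(nsq_dot_esum exh).
  have yE : x - an h = y + an (g - h).
    by rewrite anB /y addrA subrK.
  move: hP; rewrite yE (nsqD D) // yo /=.
  by have := semi_pos D (lan (g - h)); lra.
apply/funext => k; apply/eqP; rewrite -subr_eq0; apply/eqP/ComplexField.Normc.eq0_normc/eqP.
rewrite -sqrf_eq0 eq_le sqr_ge0 andbT -y0.
exact: (normc_coord_le exh k ly).
Qed.

Lemma gramE i : gram i = an (cdual i).
Proof.
have /gram_pred_unique <- // : gram_pred In ip f i
    (epsilon (inhabits (fun _ => 0)) (gram_pred In ip f i)).
by apply: epsilon_spec; exists (an (cdual i)); exact: gram_predP.
Qed.

(** Idempotence and self-adjointness of the Gram projection, read off its entries. *)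
Lemma gram_dot i j : gram i j = dot (gram i) (gram j).
Proof.
by rewrite !gramE (semi_herm D (lan _) (lan _)) (cdualP j).2 -(semi_herm S).
Qed.

Lemma gram_l2 i : l2 (gram i). Proof. by rewrite gramE. Qed.

Lemma gram_herm i j : gram i j = conjc (gram j i).
Proof. by rewrite gram_dot (semi_herm D) -?gram_dot //; exact: gram_l2. Qed.

Lemma gram_diag i : Re (gram i i) = nsq dot (gram i).
Proof. by rewrite {1}gram_dot. Qed.

(** A diagonal entry [n] equals the squared norm of its row, so [n ^ 2 <= n]. *)
Lemma gram_nsq_le1 i : nsq dot (gram i) <= 1.
Proof.
have := normc_coord_le exh i (gram_l2 i); rewrite normc2E gram_diag.
have := semi_pos D (gram_l2 i); have := sqr_ge0 (complex.Im (gram i i)).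
by move: (nsq _ _) (_ ^+ 2) => n m; nra.
Qed.

Lemma frame_bE n : frame_b In ip f n = \sum_(i <- In n) nsq dot (gram i).
Proof.
rewrite /frame_b Re_sum; apply: eq_bigr => i _.
by rewrite -gram_diag gramE /an (semi_ReC S).
Qed.

(* Row [k] of the Gram projection represents the [k]-th coordinate of the projected vector. *)
Definition gram_proj (x : I -> C) : I -> C := fun k => dot x (gram k).

Lemma gram_projP x : l2 x -> exists2 w, in_cspan ip f w &
  gram_proj x = an w /\ forall h, dot (an w) (an h) = dot x (an h).
Proof.
move=> lx; have [w Kw wP] := normal_equation FB lx; exists w => //; split=> //.
apply/funext => k; rewrite /gram_proj gramE -wP (semi_herm D) ?lan //.
by rewrite (cdualP k).2 -(semi_herm S).
Qed.

Lemma gram_projL a x y : l2 x -> l2 y ->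
  gram_proj (a *: x + y) = a *: gram_proj x + gram_proj y.
Proof.
by move=> lx ly; apply/funext => k; rewrite /gram_proj (semi_lin D) //; exact: gram_l2.
Qed.

Lemma gram_proj_l2 x : l2 x -> l2 (gram_proj x).
Proof. by move=> /gram_projP[w _ [-> _]]. Qed.

Lemma gram_proj_dist x : l2 x ->
  nsq dot (x - gram_proj x) = nsq dot x - nsq dot (gram_proj x).
Proof.
move=> lx; have [w _ [-> wP]] := gram_projP lx; rewrite (nsqB D) //.
by rewrite -wP /nsq; ring.
Qed.

Lemma gram_proj_le x : l2 x -> nsq dot (gram_proj x) <= nsq dot x.
Proof.
move=> lx; rewrite -subr_ge0 -gram_proj_dist //; apply: (semi_pos D).
by apply: (semi_closedB D) => //; exact: gram_proj_l2.
Qed.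

End Dual.
End OneFrame.
End Frames.

(** * Uniformly localised families *)

Section Localisation.
Variables (R : realType) (I : countType) (d : I -> I -> R) (In : nat -> {fset I}).
Hypothesis U : uniform_metric_index_set d In.
Local Notation C := R[i].
Local Notation normc := (@ComplexField.Normc.normc R).
Local Notation Re := complex.Re.
Local Notation dot := (dot In).
Local Notation l2 := (@l2 R I).
Let exh : nested_exhaustion In. Proof. by case: U. Qed.
Let D := dot_semi R exh.

(** Row non-expansiveness through finite sums; the radius is positive because the ball and boundary
    conditions concern positive radii. *)
Definition localised (X : I -> I -> C) := forall e : R, 0 < e -> exists2 N : R, 0 < N &
  forall i (T : {fset I}), (forall j, j \in T -> N < d j i) ->
    \sum_(j <- T) normc (X i j) ^+ 2 <= e.

Lemma row_nonexpansiveP X : row_nonexpansive d X <-> localised X.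
Proof.
have n0 (i j : I) : 0 <= normc (X i j) ^+ 2 by exact: sqr_ge0.
split=> h e e0.
  have [N NP] := h e e0; exists (Num.max N 1); first by rewrite lt_max ltr01 orbT.
  move=> i T TP; apply: (esum_leP [set j | ~ (d j i <= N)%R] e (n0 i)).1; first exact: (ltW (NP i)).
  by move=> j /TP; rewrite gt_max ltNge => /andP[/negP].
have [N N0 NP] := h (e / 2) (divr_gt0 e0 (ltr0n _ 2)).
exists N => i; apply: (@le_lt_trans _ _ (e / 2)%:E); last first.
  by rewrite lte_fin ltr_pdivrMr // ltr_pMr // ltr1n.
by apply/(esum_leP _ _ (n0 i)) => T TP; apply: NP => j /TP /= /negP; rewrite -ltNge.
Qed.

(** The hypothesis bounds finite subsets of a ball; one of maximal cardinality exhausts the ball. *)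
Lemma finite_ball (r : R) : 0 < r -> exists K : nat, forall i, exists2 T : {fset I},
  (#|` T| <= K)%N & forall j, (j \in T) = (d j i <= r).
Proof.
move=> r0; case: U => _ _ bd _; have [K KP] := bd r r0; exists K => i.
pose P n := `[< exists T : {fset I}, (forall j, j \in T -> d j i <= r) /\ #|` T| = n >].
have exP : exists n, P n by exists 0%N; apply/asboolP; exists fset0; rewrite cardfs0.
have boundP n : P n -> (n <= K)%N by move=> /asboolP[T [TP <-]]; exact: KP TP.
case: (ex_maxnP exP boundP) => n /asboolP[T [TP Tn]] maxn; exists T; first exact: KP TP.
move=> j; apply/idP/idP => [/TP //|jr]; apply/negPn/negP => jT.
have /maxn : P (#|` (j |` T)%fset|).
  by apply/asboolP; exists (j |` T)%fset; split=> // k; rewrite !inE => /predU1P[-> //|/TP].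
by rewrite cardfsU1 jT Tn add1n ltnn.
Qed.

Lemma sum_cauchy_schwarz (T : {fset I}) (x y : I -> C) :
  normc (\sum_(i <- T) x i * y i) ^+ 2 <=
  (\sum_(i <- T) normc (x i) ^+ 2) * (\sum_(i <- T) normc (y i) ^+ 2).
Proof.
pose b (x y : I -> C) : C := \sum_(i <- T) x i * conjc (y i).
have bb x' : nsq b x' = \sum_(i <- T) normc (x' i) ^+ 2.
  by rewrite /nsq Re_sum; apply: eq_bigr => i _; rewrite mulcJ ReR.
have Sb : semi_inner (@everywhere R (I -> C)) b.
  split=> //.
  - move=> a p q z _ _ _; rewrite /b mulr_sumr -big_split /=; apply: eq_bigr => i _.
    by change ((a *: p + q) i) with (a * p i + q i); rewrite mulrDl mulrA.
  - move=> p q _ _; rewrite /b rmorph_sum; apply: eq_bigr => i _ /=.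
    by rewrite rmorphM /= conjcK mulrC.
  - by move=> p _; rewrite bb sumr_ge0 // => i _; exact: sqr_ge0.
have := cauchy_schwarz Sb (x := x) (y := fun i => conjc (y i)) Logic.I Logic.I.
have -> : nsq b (fun i => conjc (y i)) = \sum_(i <- T) normc (y i) ^+ 2.
  by rewrite bb; apply: eq_bigr => i _; rewrite normc2J.
rewrite bb.
by rewrite /b; under eq_bigr do rewrite conjcK.
Qed.

Lemma localised_lin (a : C) X Y : localised X -> localised Y ->
  localised (fun i => a *: X i + Y i).
Proof.
move=> lX lY e e0; pose t := 4 * (normc a ^+ 2 + 1).
have t0 : 0 < t by rewrite mulr_gt0 // ltr_pwDr // sqr_ge0.
have [N1 N10 N1P] := lX (e / t) (divr_gt0 e0 t0).
have [N2 N20 N2P] := lY (e / 4) (divr_gt0 e0 (ltr0n _ 4)).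
exists (Num.max N1 N2); first by rewrite lt_max N10.
move=> i T TP.
have {}N1P : \sum_(j <- T) normc (X i j) ^+ 2 <= e / t.
  by apply: N1P => j /TP; rewrite gt_max => /andP[].
have {}N2P : \sum_(j <- T) normc (Y i j) ^+ 2 <= e / 4.
  by apply: N2P => j /TP; rewrite gt_max => /andP[].
apply: (@le_trans _ _ (2 * normc a ^+ 2 * \sum_(j <- T) normc (X i j) ^+ 2
   + 2 * \sum_(j <- T) normc (Y i j) ^+ 2)).
  rewrite !mulr_sumr -big_split /=; apply: ler_sum => j _; rewrite -mulrA -normc2M.
  exact: normc2D_le.
have n0 := sqr_ge0 (normc a).
have : normc a ^+ 2 * \sum_(j <- T) normc (X i j) ^+ 2 <= normc a ^+ 2 * (e / t).
  by rewrite ler_wpM2l.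
have : t * (e / t) = e by rewrite mulrC divfK // gt_eqF.
have : 0 < e / t by rewrite divr_gt0.
move: (e / t) (\sum_(j <- T) _) N2P => w x; move: (\sum_(j <- T) _) => y.
by rewrite /t; nra.
Qed.

Lemma localised_delta : localised (delta R (I := I)).
Proof.
move=> e e0; exists 1 => // i T TP; rewrite big_seq big1; first exact: ltW.
move=> j /TP; rewrite /delta; case: eqP => [->|_ _]; last first.
  by rewrite ComplexField.Normc.normc0 expr0n.
by case: U => -[_ -> _ _] _ _ _; rewrite ltr10.
Qed.

Lemma localised_limit X : (forall i, l2 (X i)) ->
  (forall e : R, 0 < e -> exists2 Y, localised Y &
     forall i, l2 (Y i) /\ nsq dot (X i - Y i) <= e) ->
  localised X.
Proof.
move=> lX H e e0; have e4 : 0 < e / 4 by rewrite divr_gt0.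
have [Y lY YP] := H _ e4; have [N N0 NP] := lY _ e4; exists N => // i T TP.
have [lYi XY] := YP i.
have h1 := le_trans (nsq_dot_ge exh T (semi_closedB D (lX i) lYi)) XY.
have h2 := NP i T TP.
apply: (@le_trans _ _ (2 * \sum_(j <- T) normc ((X i - Y i) j) ^+ 2
   + 2 * \sum_(j <- T) normc (Y i j) ^+ 2)); last by lra.
rewrite !mulr_sumr -big_split /=; apply: ler_sum => j _.
by have := normc2D_le ((X i - Y i) j) (Y i j);
  rewrite {1}[(X i - Y i) j](_ : _ = X i j - Y i j) // subrK.
Qed.

Section Projection.
Variables (V : lmodType C) (ip : V -> V -> C) (f : I -> V) (A B : R).
Hypotheses (H : hilbert ip) (FB : frame_bounds In ip f (in_cspan ip f) A B).
Local Notation gram := (gram In ip f).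
Local Notation gram_proj := (gram_proj In ip f).

(** Cut [X i] at radius [N1]. The projection contracts, so the tail stays small; the rest is sent to
    a combination of at most [K] rows [gram j] with [j] near [i], all small beyond distance
    [N1 + N2] from [i]. *)
Lemma localised_gram_proj X (M : R) : localised gram ->
  localised X -> (forall i, l2 (X i)) -> (forall i, nsq dot (X i) <= M) ->
  localised (fun i => gram_proj (X i)).
Proof.
move=> lG lX l2X XM e e0; have e4 : 0 < e / 4 by rewrite divr_gt0.
have [N1 N10 N1P] := lX _ e4; have [K KP] := finite_ball N10.
(* Chosen so that at most [K] rows with tails at most [e / c], weighted by the bound [M], contribute
   at most [e / 4]. *)
pose c := 4 * (K%:R + 1) * (`|M| + 1).
have K0 : 0 <= K%:R :> R by exact: ler0n.
have M0 : 0 <= `|M| by exact: normr_ge0.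
have c0 : 0 < c by rewrite !mulr_gt0 //; lra.
have [N2 N20 N2P] := lG (e / c) (divr_gt0 e0 c0).
exists (N1 + N2); first by rewrite addr_gt0.
move=> i T TP; have [Bl cBl BlP] := KP i.
pose t j : C := if j \in Bl then X i j else 0.
have lt2 : l2 t by apply: (@fin_supp_l2 _ _ _ Bl) => j; rewrite /t => /negbTE ->.
pose r := X i - t.
have lr : l2 r by apply: (semi_closedB D).
have rE j : r j = if j \in Bl then 0 else X i j.
  rewrite /r [(X i - t) j](_ : _ = X i j - t j) // /t; case: ifP => _; first by rewrite subrr.
  by rewrite subr0.
have r4 : nsq dot r <= e / 4.
  apply: nsq_dot_le => // S.
  rewrite (big_fsetID _ (mem Bl)) /= big_seq big1 ?add0r; last first.
    by move=> j; rewrite !inE /= => /andP[_ jB]; rewrite rE jB ComplexField.Normc.normc0 expr0n.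
  apply: le_trans (N1P i [fset x in S | x \notin Bl]%fset _); last first.
    by move=> j; rewrite !inE /= => /andP[_]; rewrite BlP -ltNge.
  rewrite big_seq [leRHS]big_seq; apply: ler_sum => j.
  by rewrite !inE /= => /andP[_ /negbTE jB]; rewrite rE jB.
have PX : gram_proj (X i) = gram_proj t + gram_proj r.
  rewrite -{1}[X i](subrK t) -/r -[r]scale1r (gram_projL exh H FB) //.
  by rewrite !scale1r addrC.
have Pr : \sum_(k <- T) normc (gram_proj r k) ^+ 2 <= e / 4.
  apply: le_trans (le_trans (gram_proj_le exh H FB lr) r4).
  by apply: (nsq_dot_ge exh); exact: (gram_proj_l2 exh H FB lr).
have Pt : \sum_(k <- T) normc (gram_proj t k) ^+ 2 <= e / 4.
  have tk k : normc (gram_proj t k) ^+ 2 <= `|M| * \sum_(j <- Bl) normc (gram j k) ^+ 2.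
    have -> : gram_proj t k = \sum_(j <- Bl) X i j * gram j k.
      rewrite [gram_proj t k](_ : _ = dot t (gram k)) // (dot_fin_supp exh (S := Bl)) //; last 2 first.
      - exact: (gram_l2 exh H FB).
      - by move=> j; rewrite /t => /negbTE ->.
      rewrite big_seq [RHS]big_seq; apply: eq_bigr => j jB.
      by rewrite /t jB [gram j k](gram_herm exh H FB).
    apply: le_trans (sum_cauchy_schwarz _ _ _) _; rewrite ler_wpM2r //.
      by rewrite sumr_ge0 // => j _; exact: sqr_ge0.
    apply: le_trans (nsq_dot_ge exh Bl (l2X i)) _.
    by apply: le_trans (XM i) (ler_norm _).
  apply: (le_trans (ler_sum _ (fun k _ => tk k))).
  rewrite -mulr_sumr exchange_big /=.
  have : \sum_(j <- Bl) \sum_(k <- T) normc (gram j k) ^+ 2 <= K%:R * (e / c).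
    apply: (@le_trans _ _ (\sum_(j <- Bl) e / c)).
      rewrite big_seq [leRHS]big_seq; apply: ler_sum => j jB; apply: N2P => k /TP ik.
      move: jB; rewrite BlP => jB; case: U => -[_ _ _ tri] _ _ _.
      by have := tri k j i; lra.
    rewrite big_const_seq count_predT iter_addr_0 -[(_ *+ _)%R]mulr_natl.
    by rewrite ler_wpM2r ?ler_nat // divr_ge0 ?ltW.
  move=> h; have h' := ler_wpM2l M0 h; apply: le_trans h' _.
  have : c * (e / c) = e by rewrite mulrC divfK // gt_eqF.
  have : 0 < e / c by rewrite divr_gt0.
  move: (e / c) => w w0; rewrite /c; move: (`|M|) (K%:R) M0 K0 => m k m0 k0 <-; nra.
rewrite PX; apply: (@le_trans _ _ (2 * \sum_(k <- T) normc (gram_proj t k) ^+ 2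
   + 2 * \sum_(k <- T) normc (gram_proj r k) ^+ 2)); last by lra.
by rewrite !mulr_sumr -big_split /=; apply: ler_sum => j _; exact: normc2D_le.
Qed.

End Projection.
End Localisation.

(** * Direct sums *)

Section DirectSum.
Variables (R : realType) (I : countType) (In : nat -> {fset I}).
Hypothesis exh : nested_exhaustion In.
Variables (V1 V2 : lmodType R[i]) (ip1 : V1 -> V1 -> R[i]) (ip2 : V2 -> V2 -> R[i]).
Variables (f1 : I -> V1) (f2 : I -> V2).
Hypotheses (H1 : hilbert ip1) (H2 : hilbert ip2).
Local Notation C := R[i].
Local Notation ip := (dsum_ip ip1 ip2).
Local Notation f := (dsum_frame f1 f2).
Let S1 := hilbert_semi H1.
Let S2 := hilbert_semi H2.

Lemma dsum_nsq p : nsq ip p = nsq ip1 p.1 + nsq ip2 p.2.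
Proof. by rewrite /nsq /dsum_ip ReD. Qed.

Lemma dsum_nsq_fst p : nsq ip1 p.1 <= nsq ip p.
Proof. by rewrite dsum_nsq lerDl; exact: (semi_pos S2). Qed.

Lemma dsum_nsq_snd p : nsq ip2 p.2 <= nsq ip p.
Proof. by rewrite dsum_nsq lerDr; exact: (semi_pos S1). Qed.

Lemma dsum_hilbert : hilbert ip.
Proof.
split.
  split=> //.
  - by move=> a x y z _ _ _; rewrite /dsum_ip /= (semi_lin S1) // (semi_lin S2) //; ring.
  - by move=> x y _ _; rewrite /dsum_ip (semi_herm S1) // (semi_herm S2 (y := y.2)) // rmorphD.
  - by move=> x _; rewrite dsum_nsq addr_ge0 //; [exact: (semi_pos S1) | exact: (semi_pos S2)].
move=> u _ cauchy.
have [//||v1 _ v1P] := hilbert_complete H1 (u := fun n => (u n).1).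
  move=> e e0; have [N NP] := cauchy e e0; exists N => m n Nm Nn.
  exact: le_lt_trans (dsum_nsq_fst (u m - u n)) (NP m n Nm Nn).
have [//||v2 _ v2P] := hilbert_complete H2 (u := fun n => (u n).2).
  move=> e e0; have [N NP] := cauchy e e0; exists N => m n Nm Nn.
  exact: le_lt_trans (dsum_nsq_snd (u m - u n)) (NP m n Nm Nn).
exists (v1, v2) => // e e0; have e20 : 0 < e / 2 by rewrite divr_gt0.
have [N1 N1P] := v1P _ e20; have [N2 N2P] := v2P _ e20.
exists (maxn N1 N2) => n; rewrite geq_max => /andP[/N1P h1 /N2P h2].
by rewrite dsum_nsq /=; lra.
Qed.

Definition cspan_prod (p : V1 * V2) := in_cspan ip1 f1 p.1 /\ in_cspan ip2 f2 p.2.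

Lemma cspan_prod_sub : subspace cspan_prod.
Proof.
have s1 := cspan_sub H1 f1; have s2 := cspan_sub H2 f2.
split; first by split; [exact: subspace0 s1 | exact: subspace0 s2].
by move=> a x y [x1 x2] [y1 y2]; split; [exact: (subspaceP s1) | exact: (subspaceP s2)].
Qed.

Lemma cspan_prod_closed : closed_for ip cspan_prod.
Proof.
move=> v h; split.
  apply: (cspan_closed H1) => e e0; have [u [u1 _] uv] := h e e0; exists u.1 => //.
  exact: le_lt_trans (dsum_nsq_fst (v - u)) uv.
apply: (cspan_closed H2) => e e0; have [u [_ u2] uv] := h e e0; exists u.2 => //.
exact: le_lt_trans (dsum_nsq_snd (v - u)) uv.
Qed.

Lemma cspan_prod_gen i : cspan_prod (f i).
Proof. by split; [exact: cspan_gen | exact: cspan_gen]. Qed.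

Lemma cspan_dsumW p : in_cspan ip f p -> cspan_prod p.
Proof.
move=> /(in_cspanP dsum_hilbert) h; apply: cspan_prod_closed => e e0.
have [s [c sc]] := h e e0; exists (\sum_(j <- s) c j *: f j) => //.
have [z0 zP] := cspan_prod_sub; elim: s {sc} => [|j s IH]; first by rewrite big_nil.
by rewrite big_cons; apply: zP => //; exact: cspan_prod_gen.
Qed.

(** The product of the spans contains the closed span of the sum, so the bounds restrict. Canonical
    duals need the closed span, whereas vectors such as [(x, 0)] are only known to lie in the
    product. *)
Lemma superframe_bounds : superframe ip1 ip2 f1 f2 -> exists A B,
  frame_bounds In ip f cspan_prod A B /\ frame_bounds In ip f (in_cspan ip f) A B.
Proof.
move=> sf.
have [A [B FB]] := frame_forW exh cspan_prod_sub cspan_prod_closed cspan_prod_gen sf.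
exists A, B; split=> //; have KW := cspan_dsumW.
split.
- exact: (cspan_sub dsum_hilbert).
- exact: (cspan_closed dsum_hilbert).
- exact: (cspan_gen dsum_hilbert).
- exact: (fb_A FB).
- exact: (fb_B FB).
- by move=> h /KW; exact: (fb_l2 FB).
- by move=> h /KW; exact: (fb_lower FB).
- by move=> h /KW; exact: (fb_upper FB).
Qed.

End DirectSum.

(** * Non-expansiveness of the direct sum *)

Section Nonexpansive.
Variables (R : realType) (I : countType) (d : I -> I -> R) (In : nat -> {fset I}).
Hypothesis U : uniform_metric_index_set d In.
Variables (V1 V2 : lmodType R[i]) (ip1 : V1 -> V1 -> R[i]) (ip2 : V2 -> V2 -> R[i]).
Variables (f1 : I -> V1) (f2 : I -> V2).
Hypotheses (H1 : hilbert ip1) (H2 : hilbert ip2).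
Variables (A1 B1 A2 B2 A B : R).
Hypotheses (FB1 : frame_bounds In ip1 f1 (in_cspan ip1 f1) A1 B1)
  (FB2 : frame_bounds In ip2 f2 (in_cspan ip2 f2) A2 B2).
Local Notation C := R[i].
Local Notation ip := (dsum_ip ip1 ip2).
Local Notation f := (dsum_frame f1 f2).
Local Notation K := (cspan_prod ip1 ip2 f1 f2).
Hypotheses (FBK : frame_bounds In ip f K A B)
  (FB : frame_bounds In ip f (in_cspan ip f) A B).
Hypotheses (L1 : localised d (gram In ip1 f1)) (L2 : localised d (gram In ip2 f2)).
Local Notation Re := complex.Re.
Local Notation dot := (dot In).
Local Notation l2 := (@l2 R I).
Local Notation P1 := (gram_proj In ip1 f1).
Local Notation P2 := (gram_proj In ip2 f2).
Local Notation gram := (gram In ip f).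
Let exh : nested_exhaustion In. Proof. by case: U. Qed.
Let D := dot_semi R exh.
Let H := dsum_hilbert H1 H2.
Let lan1 := an_l2 H1 FB1.
Let lan2 := an_l2 H2 FB2.
Let lan := an_l2 H FB.

(** The mean of the complementary projections [1 - P1] and [1 - P2]. *)
Definition relax (y : I -> C) : I -> C :=
  ((- 2^-1 : R)%:C)%C *: (P1 y + P2 y) + y.

Lemma relaxD x y : l2 x -> l2 y -> relax (x + y) = relax x + relax y.
Proof.
move=> lx ly; rewrite /relax -[x in P1 (x + _)]scale1r -[x in P2 (x + _)]scale1r.
rewrite (gram_projL exh H1 FB1) // (gram_projL exh H2 FB2) // !scale1r.
by rewrite [P1 x + P1 y + _]addrACA scalerDr addrACA.
Qed.

Lemma an_dsum h : an ip f h = an ip1 f1 h.1 + an ip2 f2 h.2.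
Proof. by []. Qed.

Let q := 1 - A / (2 * (A + B1 + B2)).

(** As a mean, [relax z] has squared norm at most that of [z] minus half the sum of those of [P1 z]
    and [P2 z]. The superframe inequality bounds this sum below by a fixed fraction of the squared
    norm of [z]. *)
Lemma relax_contracts h : K h -> exists2 h', K h' &
  relax (an ip f h) = an ip f h' /\ nsq dot (an ip f h') <= q * nsq dot (an ip f h).
Proof.
move=> Kh; set z := an ip f h; have lz : l2 z by exact: lan.
have [w1 Kw1 [P1z w1P]] := gram_projP exh H1 FB1 lz.
have [w2 Kw2 [P2z w2P]] := gram_projP exh H2 FB2 lz.
have Kw : K (w1, w2) by [].
pose h' := ((- 2^-1 : R)%:C)%C *: (w1, w2) + h.
have zE : relax z = an ip f h' by rewrite /h' (anP H) /relax P1z P2z an_dsum.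
exists h'; first by apply: (subspaceP (fb_sub FBK)).
split=> //; rewrite -zE.
have lP1 : l2 (P1 z) by rewrite P1z; exact: lan1.
have lP2 : l2 (P2 z) by rewrite P2z; exact: lan2.
have lQ1 := semi_closedB D lz lP1; have lQ2 := semi_closedB D lz lP2.
have -> : relax z = ((2^-1 : R)%:C)%C *: ((z - P1 z) + (z - P2 z)).
  rewrite addrACA -opprD scalerDr scalerN /relax rmorphN scaleNr addrC; congr (_ - _).
  rewrite -[z in _ *: (z + _)]scale1r -[z in _ *: (_ + z)]scale1r -scalerDl scalerA.
  by rewrite [X in X *: _](_ : _ = 1) ?scale1r //; apply: eqC; rewrite !ReImE /=; field.
rewrite (nsqZ D); last exact: (semi_closedD D).
rewrite normc_real ger0_norm; last by rewrite invr_ge0.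
have := nsqD_le D lQ1 lQ2; have := gram_proj_dist exh H1 FB1 lz.
have := gram_proj_dist exh H2 FB2 lz.
have lower : A * nsq dot z <= (A + B1 + B2) * (nsq dot (P1 z) + nsq dot (P2 z)).
  have A0 := fb_A FB; have B10 := fb_B FB1; have B20 := fb_B FB2.
  set Bm := A + B1 + B2; have Bm0 : 0 < Bm by rewrite /Bm; lra.
  have zz : nsq dot z = Re (dot (P1 z) (an ip1 f1 h.1)) + Re (dot (P2 z) (an ip2 f2 h.2)).
    by rewrite P1z P2z w1P w2P -ReD -(semiDr D).
  (* With this weight in Young's inequality the terms in [h.1] and [h.2] add up to at most
     [nsq dot z], which is absorbed by twice [nsq dot z] on the left. *)
  have s0 : 0 < Bm / A by rewrite divr_gt0.
  have e1 := Re_semi_le D s0 lP1 (lan1 h.1); have e2 := Re_semi_le D s0 lP2 (lan2 h.2).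
  have u1 := fb_upper FB1 Kh.1; have u2 := fb_upper FB2 Kh.2; have lo := fb_lower FBK Kh.
  have n1 : 0 <= nsq ip1 h.1 by exact: (semi_pos (hilbert_semi H1)).
  have n2 : 0 <= nsq ip2 h.2 by exact: (semi_pos (hilbert_semi H2)).
  move: lo; rewrite (dsum_nsq ip1 ip2) -/z => lo.
  have tot : nsq dot (an ip1 f1 h.1) + nsq dot (an ip2 f2 h.2) <= Bm / A * nsq dot z.
    rewrite mulrAC ler_pdivlMr // mulrC.
    apply: (@le_trans _ _ (A * (Bm * (nsq ip1 h.1 + nsq ip2 h.2)))).
      rewrite ler_pM2l // mulrDr; apply: lerD.
        by apply: le_trans u1 _; rewrite ler_wpM2r // /Bm; lra.
      by apply: le_trans u2 _; rewrite ler_wpM2r // /Bm; lra.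
    by rewrite mulrCA ler_pM2l.
  have : (Bm / A)^-1 * (nsq dot (an ip1 f1 h.1) + nsq dot (an ip2 f2 h.2)) <= nsq dot z.
    by rewrite mulrC ler_pdivrMr // mulrC.
  move=> h3; have {e1 e2 zz} : nsq dot z <= Bm / A * (nsq dot (P1 z) + nsq dot (P2 z)).
    by move: e1 e2 h3; rewrite zz !mulrDr; lra.
  by rewrite mulrAC ler_pdivlMr // mulrC.
have Bm0 : 0 < A + B1 + B2 by have := fb_A FB; have := fb_B FB1; have := fb_B FB2; lra.
have {}lower : A / (A + B1 + B2) * nsq dot z <= nsq dot (P1 z) + nsq dot (P2 z).
  by rewrite mulrAC ler_pdivrMr // [leRHS]mulrC.
have -> : q = 1 - A / (A + B1 + B2) / 2.
  by rewrite /q; field; rewrite gt_eqF.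
move: lower; set a := A / _; move: (nsq dot z) => n; lra.
Qed.

Lemma q_lt1 : `|q| < 1.
Proof.
have A0 := fb_A FB; have B10 := fb_B FB1; have B20 := fb_B FB2.
have t0 : 0 < 2 * (A + B1 + B2) by lra.
have : 0 < A / (2 * (A + B1 + B2)) by rewrite divr_gt0.
have : A / (2 * (A + B1 + B2)) < 1 by rewrite ltr_pdivrMr // mul1r; lra.
by rewrite /q; move: (A / _) => x x1 x0; rewrite ger0_norm; lra.
Qed.

Let delta i : I -> C := delta R i.
Let res i : I -> C := delta i - gram i.

Let ldelta i : l2 (delta i). Proof. exact: delta_l2. Qed.
Let lgram i : l2 (gram i). Proof. exact: (gram_l2 exh H FB). Qed.
Let lres i : l2 (res i). Proof. exact: (semi_closedB D). Qed.

Lemma res_orth i h : dot (res i) (an ip f h) = 0.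
Proof.
rewrite (semiBl D) //.
rewrite (gramE exh H FB) (cdualP exh H FB i).2 (dot_delta exh) //.
by rewrite /an -(semi_herm (hilbert_semi H)) // subrr.
Qed.

(** The residual is orthogonal to both component ranges, as is seen by testing with vectors having
    one zero component. *)
Lemma relax_res i : relax (res i) = res i.
Proof.
rewrite /relax; have -> : P1 (res i) = 0.
  apply/funext => k; rewrite /gram_proj (gramE exh H1 FB1).
  rewrite -[RHS](res_orth i (cdual In ip1 f1 k, 0)); congr dot.
  by apply/funext => j; rewrite /an /dsum_ip /= (semi0l (hilbert_semi H2)) // addr0.
have -> : P2 (res i) = 0.
  apply/funext => k; rewrite /gram_proj (gramE exh H2 FB2).
  rewrite -[RHS](res_orth i (0, cdual In ip2 f2 k)); congr dot.
  by apply/funext => j; rewrite /an /dsum_ip /= (semi0l (hilbert_semi H1)) // add0r.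
by rewrite addr0 scaler0 add0r.
Qed.

(** The residual part is fixed, while the part in the range, initially [gram i], shrinks at a rate
    independent of [i]. *)
Lemma relax_iter k i : exists2 h, K h &
  iter k relax (delta i) = res i + an ip f h /\ nsq dot (an ip f h) <= `|q| ^+ k.
Proof.
elim: k => [|k [h Kh [yE hq]]].
  exists (cdual In ip f i).
    by apply: (cspan_dsumW H1 H2); have [] := cdualP exh H FB i.
  rewrite -(gramE exh H FB) /= expr0; split; last exact: (gram_nsq_le1 exh H FB).
  by rewrite /res subrK.
have [h' Kh' [rE h'q]] := relax_contracts Kh; exists h' => //; split.
  by rewrite iterS yE relaxD // relax_res rE.
apply: (le_trans h'q); rewrite exprS; apply: le_trans (_ : `|q| * nsq dot (an ip f h) <= _).
  by rewrite ler_wpM2r ?ler_norm // (semi_pos D) //; exact: lan.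
by rewrite ler_wpM2l.
Qed.

Lemma relax_iter_l2 k i : l2 (iter k relax (delta i)).
Proof.
by have [h _ [-> _]] := relax_iter k i; apply: (semi_closedD D) => //; exact: lan.
Qed.

Lemma nsq_delta i : nsq dot (delta i) = 1.
Proof. by rewrite /nsq (dot_delta exh) // /delta /Defs.delta eqxx conjc1. Qed.

(** The residual has squared norm at most [4], the other part at most [1], whence [2 * 4 + 2 * 1].
    What matters is uniformity in [i]. *)
Lemma relax_iter_bound k i : nsq dot (iter k relax (delta i)) <= 10.
Proof.
have [h _ [-> hq]] := relax_iter k i.
apply: le_trans (nsqD_le D (lres i) (lan h)) _.
have := nsqB_le D (ldelta i) (lgram i); rewrite nsq_delta -/(res i).
have : `|q| ^+ k <= 1 by rewrite exprn_ile1 // ltW // q_lt1.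
by have := gram_nsq_le1 exh H FB i; lra.
Qed.

Lemma relax_iter_localised k : localised d (fun i => iter k relax (delta i)).
Proof.
elim: k => [|k IH] /=; first exact: (localised_delta U).
have ll := relax_iter_l2 k; have bd := relax_iter_bound k.
have p1 := localised_gram_proj U H1 FB1 L1 IH ll bd.
have p2 := localised_gram_proj U H2 FB2 L2 IH ll bd.
apply: (localised_lin _ _ IH); have := localised_lin 1 p1 p2; congr localised.
by apply/funext => i; rewrite scale1r.
Qed.

Lemma superframe_localised : localised d gram.
Proof.
apply: (localised_limit U) => // e e0.
have [k kq] : exists k, `|q| ^+ k <= e.
  have /cvgrPdist_lt /(_ _ e0) [k _ kP] := cvg_expr q_lt1.
  exists k; have := kP k (leqnn k); rewrite /= sub0r normrN normrX => /ltW //.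
have l1 := localised_lin (- 1) (relax_iter_localised k) (localised_delta U).
eexists; first exact: l1.
move=> i; have [h _ [yE hq]] := relax_iter k i; cbn beta.
have -> : -1 *: iter k relax (delta i) + Defs.delta R i = gram i - an ip f h.
  rewrite yE scaleN1r /res -/(delta i) !opprD opprK.
  by rewrite addrC !addrA subrr add0r.
split; first by apply: (semi_closedB D) => //; exact: lan.
by rewrite opprB addrC subrK; exact: le_trans hq kq.
Qed.

End Nonexpansive.

(** * Vanishing trace density of commutators *)

Section Trace.
Variables (R : realType) (I : countType) (d : I -> I -> R) (In : nat -> {fset I}).
Hypothesis U : uniform_metric_index_set d In.
Local Notation C := R[i].
Local Notation normc := (@ComplexField.Normc.normc R).
Local Notation Re := complex.Re.
Local Notation dot := (dot In).
Local Notation l2 := (@l2 R I).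
Let exh : nested_exhaustion In. Proof. by case: U. Qed.

Lemma cvgn_sum (s : seq I) (u : I -> nat -> R) (l : I -> R) :
  (forall i, u i @ \oo --> l i) ->
  (fun n => \sum_(i <- s) u i n) @ \oo --> \sum_(i <- s) l i.
Proof.
move=> h; elim: s => [|i s IH].
  by under eq_fun do rewrite big_nil; rewrite big_nil; exact: cvg_cst.
by under eq_fun do rewrite big_cons; rewrite big_cons; apply: cvgD.
Qed.

Lemma cvgn_norm_le (u : nat -> R) (l b : R) N : u @ \oo --> l ->
  (forall n, (N <= n)%N -> `|u n| <= b) -> `|l| <= b.
Proof.
move=> ul ub; suff small (e : R) : 0 < e -> `|l| <= e + b.
  by apply/ler_addgt0Pl => e e0; exact: small.
move=> e0; have /cvgrPdist_lt /(_ _ e0) [k _ kP] := ul.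
have := kP (maxn k N) (leq_maxl _ _); have := ub (maxn k N) (leq_maxr _ _).
rewrite /=; set v := u _ => vb lv; rewrite -[l](subrK v).
by apply: le_trans (ler_normD _ _) _; rewrite lerD // ltW.
Qed.

(** The weight [s] will be small away from the boundary and [1] on it. *)
Lemma Re_mul_norm_le (x y : C) (s : R) : 0 < s ->
  2 * `|Re (x * y)| <= s^-1 * normc x ^+ 2 + s * normc y ^+ 2.
Proof.
move=> s0; rewrite !normc2E ReM.
have sV : s * s^-1 = 1 by rewrite mulfV // gt_eqF.
have sV0 : 0 < s^-1 by rewrite invr_gt0.
move: (Re x) (complex.Im x) (Re y) (complex.Im y) (s^-1) sV sV0 => a b c e t st t0.
have h u v : 0 <= t * (u - s * v) ^+ 2 by rewrite mulr_ge0 ?sqr_ge0 ?ltW.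
have hE u v : t * (u - s * v) ^+ 2 = t * u ^+ 2 + s * v ^+ 2 - 2 * (u * v).
  transitivity (t * u ^+ 2 + s * t * (s * v ^+ 2) - 2 * (s * t) * (u * v)); first by ring.
  by rewrite st; ring.
have h1 := h a c; have h2 := h b (- e); have h3 := h a (- c); have h4 := h b e.
move: h1 h2 h3 h4; rewrite !hE => h1 h2 h3 h4.
by case: (ger0P (a * c - b * e)) => _; lra.
Qed.

(* Row [i] of each matrix is the image of [delta i]. [Q] is the adjoint of [E]; [EP] and [PE] are the
   diagonals of the matrix identities [E P = E] and [P E = P]. *)
Variables (P E Q : I -> I -> C) (M : R).
Hypotheses (lP : forall i, l2 (P i)) (lE : forall i, l2 (E i)) (lQ : forall i, l2 (Q i)).
Hypotheses (nP : forall i, nsq dot (P i) <= 1) (nE : forall i, nsq dot (E i) <= M)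
  (nQ : forall i, nsq dot (Q i) <= M).
Hypotheses (Pherm : forall i j, P i j = conjc (P j i)) (QE : forall i j, Q i j = conjc (E j i)).
Hypotheses (EP : forall i, dot (E i) (P i) = E i i) (PE : forall i, dot (P i) (Q i) = P i i).
Hypothesis locP : localised d P.

(** Summand of the diagonal of the commutator of [E] and [P], antisymmetric in [i] and [j]. *)
Let term i j : R := Re (E i j * P j i) - Re (P i j * E j i).

Lemma term_sum_le (T : {fset I}) i (s : R) : 0 < s ->
  `|\sum_(j <- T) term i j| <= s^-1 * (\sum_(j <- T) normc (P i j) ^+ 2) + s * M.
Proof.
move=> s0; apply: le_trans (ler_norm_sum _ _ _) _.
have nT : \sum_(j <- T) normc (E i j) ^+ 2 <= M := le_trans (nsq_dot_ge exh T (lE i)) (nE i).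
have nT' : \sum_(j <- T) normc (Q i j) ^+ 2 <= M := le_trans (nsq_dot_ge exh T (lQ i)) (nQ i).
apply: (@le_trans _ _ (\sum_(j <- T) (s^-1 * normc (P i j) ^+ 2 +
   s / 2 * (normc (E i j) ^+ 2 + normc (Q i j) ^+ 2)))).
  apply: ler_sum => j _; apply: le_trans (ler_normB _ _) _.
  have := Re_mul_norm_le (P j i) (E i j) s0; have := Re_mul_norm_le (P i j) (E j i) s0.
  rewrite [P j i * _]mulrC QE Pherm !normc2J.
  by move: (s^-1 * _) => w; lra.
rewrite big_split /= -!mulr_sumr big_split /= lerD2l.
have : s / 2 * (\sum_(j <- T) normc (E i j) ^+ 2 + \sum_(j <- T) normc (Q i j) ^+ 2)
   <= s / 2 * (M + M) by rewrite ler_pM2l ?divr_gt0 // lerD.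
by move/le_trans; apply; rewrite le_eqVlt; apply/orP; left; apply/eqP; field.
Qed.

Let tr n : R := \sum_(i <- In n) (Re (E i i) - Re (P i i)).

Lemma trace_cvg n :
  (fun N => \sum_(i <- In n) \sum_(j <- (In N)) term i j) @ \oo --> tr n.
Proof.
apply: (@cvgn_sum _ (fun i N => \sum_(j <- In N) term i j)
  (fun i => Re (E i i) - Re (P i i))) => i.
have /cvgCP[+ _] := dot_cvg exh (lE i) (lP i).
have /cvgCP[+ _] := dot_cvg exh (lP i) (lQ i).
rewrite EP PE => c1 c2.
have -> : (fun N => \sum_(j <- In N) term i j) =
    (fun N => Re (psum In (fun j => E i j * conjc (P i j)) N) -
              Re (psum In (fun j => P i j * conjc (Q i j)) N)).
  apply/funext => N; rewrite !Re_sum -sumrB; apply: eq_bigr => j _.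
  by rewrite /term QE conjcK -Pherm.
exact: cvgB c2 c1.
Qed.

Lemma term_anti n : \sum_(i <- In n) \sum_(j <- In n) term i j = 0.
Proof.
under eq_bigr do rewrite sumrB; rewrite sumrB; apply/eqP; rewrite subr_eq0; apply/eqP.
rewrite exchange_big /=; apply: eq_bigr => i _; apply: eq_bigr => j _.
by rewrite mulrC.
Qed.

(** By antisymmetry only pairs leaving [In n] survive. For [i] off the boundary part the partner is
    farther than [r], so localisation of [P] gives at most [e]; any other [i] gives at most
    [1 + M]. *)
Lemma trace_bound (e : R) : 0 < e -> exists2 r : R, 0 < r & forall n,
  `|tr n| <= #|` In n|%:R * e + #|` boundary_part d In r n|%:R * (1 + M).
Proof.
move=> e0.
(* The term [s * M] takes one half of [e]; localisation to precision [s * (e / 2)], divided by [s],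
   takes the other. *)
pose s := e / (2 * (`|M| + 1)).
have s0 : 0 < s by rewrite divr_gt0 // mulr_gt0 // ltr_wpDl.
have sM : s * M <= e / 2.
  have : s * (`|M| + 1) = e / 2.
    by rewrite /s; field; rewrite gt_eqF // ltr_wpDl.
  move=> <-; rewrite ler_pM2l //; have := ler_norm M; lra.
have t0 : 0 < s * (e / 2) by rewrite mulr_gt0 // divr_gt0.
have [r r0 rP] := locP t0; exists r => // n.
apply: (@cvgn_norm_le _ _ _ n (@trace_cvg n)) => N nN.
have sub := In_mono exh nN.
have -> : \sum_(i <- In n) \sum_(j <- In N) term i j =
    \sum_(i <- In n) \sum_(j <- (In N `\` In n)%fset) term i j.
  under eq_bigr do rewrite (sum_fsubset _ sub).
  by rewrite big_split /= term_anti add0r.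
set T := (In N `\` In n)%fset.
apply: le_trans (ler_norm_sum _ _ _) _.
have bsub : (boundary_part d In r n `<=` In n)%fset.
  by apply/fsubsetP => i; rewrite !inE => /andP[].
apply: (@le_trans _ _ (\sum_(i <- In n) (e + (i \in boundary_part d In r n)%:R * (1 + M)))).
  rewrite big_seq [leRHS]big_seq; apply: ler_sum => i iIn.
  case: (boolP (i \in boundary_part d In r n)) => ib; rewrite ?mul1r ?mul0r.
    apply: le_trans (term_sum_le T i ltr01) _; rewrite invr1 !mul1r.
    have := le_trans (nsq_dot_ge exh T (lP i)) (nP i); lra.
  apply: le_trans (term_sum_le T i s0) _.
  have : \sum_(j <- T) normc (P i j) ^+ 2 <= s * (e / 2).
    apply: rP => j; rewrite !inE => /andP[jn _]; rewrite ltNge; apply/negP => dj.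
    move: ib; rewrite !inE iIn /= => /asboolP; apply; exists j; split=> //.
    by case: U => -[_ _ -> _].
  by rewrite -ler_pdivrMl // => h; lra.
rewrite big_split /= big_const_seq count_predT iter_addr_0 mulr_natl lerD2l -mulr_suml.
have -> : \sum_(i <- In n) (i \in boundary_part d In r n)%:R =
    \sum_(i <- boundary_part d In r n) 1 :> R.
  rewrite (sum_fsubset _ bsub) [X in _ + X]big1_seq ?addr0.
    by rewrite big_seq [RHS]big_seq; apply: eq_bigr => i ->.
  by move=> i /= ; rewrite inE => /andP[/negbTE ->].
by rewrite big_const_seq count_predT iter_addr_0.
Qed.

Lemma trace_commutator : (fun n => tr n / #|` In n|%:R) @ \oo --> (0 : R).
Proof.
apply/cvgrPdist_lt => e e0; have e2 : 0 < e / 2 by rewrite divr_gt0.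
have [r r0 rP] := trace_bound e2.
pose M' := `|M| + 1; have M'0 : 0 < M' + 1 by have := normr_ge0 M; rewrite /M'; lra.
case: U => _ _ _ /(_ _ r0) /cvgrPdist_lt /(_ _ (divr_gt0 e2 M'0)) [k _ kP].
exists k => // n /kP /=; rewrite !sub0r !normrN.
set c := #|` In n|%:R; set b := #|` _|%:R; have c0 : 0 <= c by exact: ler0n.
have b0 : 0 <= b by exact: ler0n.
have ci : 0 <= c^-1 by rewrite invr_ge0.
rewrite (ger0_norm (mulr_ge0 b0 ci)) => bc; rewrite normrM (ger0_norm ci).
apply: (le_lt_trans (ler_wpM2r ci (rP n))); rewrite -/c -/b mulrDl.
have h1 : c * (e / 2) / c <= e / 2.
  (* [In n] may be empty; the quotient by [0] is then [0]. *)
  have [->|cn] := eqVneq c 0; first by rewrite !mul0r ltW.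
  by rewrite mulrAC mulfV // mul1r.
have h2 : b * (1 + M) / c < e / 2.
  rewrite mulrAC; apply: (@le_lt_trans _ _ (b / c * (M' + 1))).
    by rewrite ler_wpM2l ?divr_ge0 // /M'; have := ler_norm M; lra.
  by rewrite -ltr_pdivlMr.
by lra.
Qed.

End Trace.

(** * Oblique against Gram projection for one summand *)

Section Component.
Variables (R : realType) (I : countType) (d : I -> I -> R) (In : nat -> {fset I}).
Hypothesis U : uniform_metric_index_set d In.
Variables (V V1 : lmodType R[i]) (ip : V -> V -> R[i]) (ip1 : V1 -> V1 -> R[i]).
(** [pr] and [inj] abstract a coordinate projection and inclusion of the direct sum, so that one
    argument serves both summands. *)
Variables (f : I -> V) (f1 : I -> V1) (K : V -> Prop) (pr : V -> V1) (inj : V1 -> V).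
Hypotheses (H : hilbert ip) (H1 : hilbert ip1).
Variables (A B A1 B1 : R).
Hypotheses (FBK : frame_bounds In ip f K A B)
  (FB : frame_bounds In ip f (in_cspan ip f) A B)
  (FB1 : frame_bounds In ip1 f1 (in_cspan ip1 f1) A1 B1).
Hypotheses (subK : forall h, in_cspan ip f h -> K h)
  (prK : forall h, K h -> in_cspan ip1 f1 (pr h))
  (injK : forall x, in_cspan ip1 f1 x -> K (inj x))
  (pr_le : forall h, nsq ip1 (pr h) <= nsq ip h)
  (inj_adj : forall x h, ip (inj x) h = ip1 x (pr h))
  (pr_inj : forall x, pr (inj x) = x) (prf : forall i, pr (f i) = f1 i).
Hypothesis L1 : localised d (gram In ip1 f1).
Local Notation Re := complex.Re.
Local Notation dot := (dot In).
Let exh : nested_exhaustion In. Proof. by case: U. Qed.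
Let D := dot_semi R exh.
Let S := hilbert_semi H.
Let S1 := hilbert_semi H1.
Let lan := an_l2 H FB.
Let lan1 := an_l2 H1 FB1.
Local Notation g := (cdual In ip f).
Local Notation a := (cdual In ip1 f1).

Lemma an_inj x : an ip f (inj x) = an ip1 f1 x.
Proof. by apply/funext => i; rewrite /an inj_adj prf. Qed.

(** The upper frame bound at [f1 k], keeping only coordinate [k], reads [n ^ 2 <= B1 * n] for the
    squared norm [n]. *)
Lemma gen_bound k : nsq ip1 (f1 k) <= B1.
Proof.
have F0 := fb_gen FB1 k; have B0 := fb_B FB1; have S0 := semi_pos S1 (_ : everywhere (f1 k)).
have := le_trans (normc_coord_le exh k (lan1 (f1 k))) (fb_upper FB1 F0).
rewrite /an (semi_diag S1) // normc2E !ReImE expr0n addr0.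
have := S0 Logic.I; rewrite le_eqVlt => /predU1P[<- _|n0]; first exact: ltW.
by rewrite expr2 ler_pM2r.
Qed.

Lemma cdual_bound i : nsq ip1 (pr (g i)) <= A^-1.
Proof.
have [Kg gP] := cdualP exh H FB i; apply: le_trans (pr_le _) _.
rewrite -[A^-1]mulr1 ler_pdivlMl ?(fb_A FB) //.
apply: le_trans (fb_lower FB Kg) _; rewrite -(gramE exh H FB).
exact: (gram_nsq_le1 exh H FB).
Qed.

(* The commutator argument for the Gram projection of [f1] and the oblique projection with rows
   [an ip1 f1 (pr (g i))]; the columns of the latter are the analysis sequences of the preimages
   of [inj (f1 k)] under the frame operator of [f]. *)
Lemma component_trace :
  (fun n => (\sum_(i <- In n) (Re (ip1 (pr (g i)) (f1 i)) - Re (gram In ip1 f1 i i)))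
     / #|` In n|%:R) @ \oo --> (0 : R).
Proof.
have A0 := fb_A FB; have B10 := fb_B FB1.
have /choice [w wP] k : exists w, K w /\ forall h, K h ->
    dot (an ip f w) (an ip f h) = ip1 (f1 k) (pr h).
  have [w Kw wP] := frame_op_surj exh H FBK (inj (f1 k)).
  by exists w; split=> // h Kh; rewrite wP // inj_adj.
have Kg i : K (g i) by apply: subK; have [] := cdualP exh H FB i.
have Ka i : in_cspan ip1 f1 (a i) by have [] := cdualP exh H1 FB1 i.
have gE i := gramE exh H1 FB1 i.
apply: (@trace_commutator _ _ _ _ U (gram In ip1 f1) (fun i => an ip1 f1 (pr (g i)))
  (fun k => an ip f (w k)) (B1 * A^-1)).
- exact: (gram_l2 exh H1 FB1).
- by move=> i; exact: lan1.
- by move=> i; exact: lan.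
- exact: (gram_nsq_le1 exh H1 FB1).
- move=> i; apply: le_trans (fb_upper FB1 (prK (Kg i))) _.
  by rewrite ler_pM2l // cdual_bound.
(* The squared norm of [an ip f (w k)] is the real part of [ip1 (f1 k) (pr (w k))]; Young with
   weight [A^-1] and the lower frame bound let it absorb the term in [w k]. *)
- move=> k; have [Kw wk] := wP k.
  have s0 : 0 < A^-1 by rewrite invr_gt0.
  have := Re_semi_le S1 s0 (_ : everywhere (f1 k)) (_ : everywhere (pr (w k))).
  move=> /(_ Logic.I Logic.I); rewrite -wk // invrK.
  have := fb_lower FBK Kw; have : A * nsq ip1 (pr (w k)) <= A * nsq ip (w k).
    by rewrite ler_pM2l.
  have : A^-1 * nsq ip1 (f1 k) <= A^-1 * B1 by rewrite ler_pM2l // gen_bound.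
  by rewrite [B1 * _]mulrC /nsq; lra.
- exact: (gram_herm exh H1 FB1).
(* Adjointness: both entries equal [ip1 (f1 i) (pr (g j))], by the equations defining [g j] and
   [w i]. *)
- move=> i j; have [Kw wk] := wP i.
  rewrite {1}/an (semi_herm S (y := w i)) // -(cdualP exh H FB j).2.
  rewrite -(semi_herm D (lan _) (lan _)) wk //.
  by rewrite /an -(semi_herm S1).
(* The oblique row lies in the range of the analysis operator of [f1], which the Gram projection
   fixes. *)
- move=> i; rewrite gE (semi_herm D (lan1 _) (lan1 _)) (cdualP exh H1 FB1 i).2.
  by rewrite /an -(semi_herm S1).
(* The Gram row is the analysis sequence of [inj (a i)], and the oblique projection fixes it. *)
- move=> i; have [Kw wk] := wP i; rewrite gE -an_inj (semi_herm D (lan _) (lan _)) wk; last exact: injK.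
  by rewrite pr_inj -(semi_herm S1) // an_inj.
- exact: L1.
Qed.

End Component.

Lemma eq_cvgn (R : realType) (u v : nat -> R) (l : R) : u =1 v ->
  u @ \oo --> l -> v @ \oo --> l.
Proof. by move=> /funext ->. Qed.

(** * Partial sums as differences of scaled frame compatible sequences *)

Section Measure.
Variables (R : realType) (I : countType) (In : nat -> {fset I}).
Hypothesis exh : nested_exhaustion In.

(** Dividing by [c] gives a frame compatible sequence; the subtracted element of [Xplus] is zero. *)
Lemma partial_sums_XR (a : I -> R) (c : R) : 0 < c -> (forall i, 0 <= a i <= c) ->
  XR In (fun n => \sum_(i <- In n) a i).
Proof.
move=> c0 ac; have a01 i : 0 <= a i / c <= 1.
  by have /andP[a0 a1] := ac i; rewrite divr_ge0 ?(ltW c0) // ler_pdivrMr // mul1r.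
have fc : frame_compatible In (fun n => \sum_(i <- In n) a i / c).
  have bd (T : {fset I}) : 0 <= \sum_(i <- T) a i / c <= #|` T|%:R.
    rewrite sumr_ge0 => [/=|i _]; last by case/andP: (a01 i).
    apply: (@le_trans _ _ (\sum_(i <- T) 1)); first by apply: ler_sum => i _; case/andP: (a01 i).
    by rewrite big_const_seq count_predT iter_addr_0.
  by split=> [|n]; [exact: bd | rewrite (sum_fsubset _ (exh.1 n)) addrC addKr].
have X0 : Xplus In (fun n => c * \sum_(i <- In n) a i / c).
  by exists c, (fun n => \sum_(i <- In n) a i / c); split; first exact: ltW.
have X1 : Xplus In (fun n => 0 * \sum_(i <- In n) a i / c).
  by exists 0, (fun n => \sum_(i <- In n) a i / c).
exists (fun n => c * \sum_(i <- In n) a i / c), (fun n => 0 * \sum_(i <- In n) a i / c).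
split=> //; split=> //.
apply/funext => n; rewrite mul0r subr0 mulr_sumr; apply: eq_bigr => i _.
by rewrite mulrC divfK // gt_eqF.
Qed.

End Measure.

(** * Non-expansiveness and additivity for superframes *)

Theorem theorem7p14 (R : realType) (I : countType) (d : I -> I -> R)
  (In : nat -> {fset I}) (W : topologicalType) (m : (nat -> R) -> W -> R)
  (V1 V2 : lmodType R[i]) (ip1 : V1 -> V1 -> R[i]) (ip2 : V2 -> V2 -> R[i])
  (f1 : I -> V1) (f2 : I -> V2) :
  uniform_metric_index_set d In ->
  compact [set: W] -> hausdorff_space W ->
  seq_measure_function In m ->
  is_hilbert ip1 -> is_hilbert ip2 ->
  in_FI ip1 f1 -> in_FI ip2 f2 ->
  nonexpansive_frame d In ip1 f1 -> nonexpansive_frame d In ip2 f2 ->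
  superframe ip1 ip2 f1 f2 ->
  nonexpansive_frame d In (dsum_ip ip1 ip2) (dsum_frame f1 f2) /\
  m (frame_b In (dsum_ip ip1 ip2) (dsum_frame f1 f2)) =
    (fun w => m (frame_b In ip1 f1) w + m (frame_b In ip2 f2) w).
Proof.
move=> U _ _ [_ mlin mapprox _ _] /is_hilbertW H1 /is_hilbertW H2 F1 F2.
move=> [/row_nonexpansiveP L1 _] [/row_nonexpansiveP L2 _] sf.
have exh : nested_exhaustion In by case: U.
have [A1 [B1 FB1]] := frame_forW exh (cspan_sub H1 f1) (cspan_closed H1 (f := f1))
  (cspan_gen H1 f1) F1.
have [A2 [B2 FB2]] := frame_forW exh (cspan_sub H2 f2) (cspan_closed H2 (f := f2))
  (cspan_gen H2 f2) F2.
have [A [B [FBK FB]]] := superframe_bounds exh H1 H2 sf.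
have H := dsum_hilbert H1 H2; have D := dot_semi R exh.
set ip := dsum_ip ip1 ip2 in FBK FB H *; set f := dsum_frame f1 f2 in FBK FB *.
have L : localised d (gram In ip f) := superframe_localised U H1 H2 FB1 FB2 FBK FB L1 L2.
split.
  split; apply/row_nonexpansiveP => //.
  (* The Gram matrix is Hermitian, so the row condition gives the column condition. *)
  have -> // : adjoint_entries (gram In ip f) = gram In ip f.
  by apply/funext => i; apply/funext => j; rewrite /adjoint_entries -(gram_herm exh H FB).
have nsq01 (V : lmodType R[i]) (ip' : V -> V -> R[i]) (f' : I -> V) (A' B' : R)
    (H' : hilbert ip') (FB' : frame_bounds In ip' f' (in_cspan ip' f') A' B') i :
    0 <= nsq (dot In) (gram In ip' f' i) <= 1.
  by rewrite (gram_nsq_le1 exh H' FB') andbT (semi_pos D) //; exact: (gram_l2 exh H' FB').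
have b1E : frame_b In ip1 f1 = fun n => \sum_(i <- In n) nsq (dot In) (gram In ip1 f1 i).
  by apply/funext => n; exact: (frame_bE exh H1 FB1).
have b2E : frame_b In ip2 f2 = fun n => \sum_(i <- In n) nsq (dot In) (gram In ip2 f2 i).
  by apply/funext => n; exact: (frame_bE exh H2 FB2).
have bE : frame_b In ip f = fun n => \sum_(i <- In n) nsq (dot In) (gram In ip f i).
  by apply/funext => n; exact: (frame_bE exh H FB).
have X1 : XR In (frame_b In ip1 f1).
  by rewrite b1E; apply: (partial_sums_XR exh ltr01) => i; exact: nsq01 H1 FB1 i.
have X2 : XR In (frame_b In ip2 f2).
  by rewrite b2E; apply: (partial_sums_XR exh ltr01) => i; exact: nsq01 H2 FB2 i.
have X : XR In (frame_b In ip f).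
  by rewrite bE; apply: (partial_sums_XR exh ltr01) => i; exact: nsq01 H FB i.
have X12 : XR In (fun n => 1 * frame_b In ip1 f1 n + 1 * frame_b In ip2 f2 n).
  have -> : (fun n => 1 * frame_b In ip1 f1 n + 1 * frame_b In ip2 f2 n) =
      fun n => \sum_(i <- In n) (nsq (dot In) (gram In ip1 f1 i) + nsq (dot In) (gram In ip2 f2 i)).
    by apply/funext => n; rewrite !mul1r b1E b2E big_split.
  (* The summands are bounded by [2], one for each frame. *)
  apply: (partial_sums_XR exh (ltr0n R 2)) => i.
  have /andP[x0 x1] := nsq01 _ _ _ _ _ H1 FB1 i; have /andP[y0 y1] := nsq01 _ _ _ _ _ H2 FB2 i.
  by lra.
have -> : (fun w => m (frame_b In ip1 f1) w + m (frame_b In ip2 f2) w) =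
    m (fun n => 1 * frame_b In ip1 f1 n + 1 * frame_b In ip2 f2 n).
  by rewrite mlin //; apply/funext => w; rewrite !mul1r.
(* Equality of measures amounts to a difference of vanishing density, supplied by [component_trace]
   for the two summands. *)
apply/mapprox => //; rewrite /seq_approx.
have c1 := @component_trace _ _ _ _ U _ _ ip ip1 f f1 _ fst (fun x => (x, 0)) H H1 _ _ _ _
  FBK FB FB1 (cspan_dsumW H1 H2 (f1 := f1) (f2 := f2)).
have c2 := @component_trace _ _ _ _ U _ _ ip ip2 f f2 _ snd (fun x => (0, x)) H H2 _ _ _ _
  FBK FB FB2 (cspan_dsumW H1 H2 (f1 := f1) (f2 := f2)).
have {}c1 := c1 (fun h Kh => proj1 Kh)
  (fun x Kx => conj Kx (subspace0 (cspan_sub H2 f2))) (dsum_nsq_fst ip1 H2).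
have {}c2 := c2 (fun h Kh => proj2 Kh)
  (fun x Kx => conj (subspace0 (cspan_sub H1 f1)) Kx) (dsum_nsq_snd ip2 H1).
have {}c1 := c1 _ (fun x => erefl) (fun i => erefl) L1.
have {}c2 := c2 _ (fun x => erefl) (fun i => erefl) L2.
have z1 x h : ip (x, 0) h = ip1 x h.1.
  by rewrite /ip /dsum_ip /= (semi0l (hilbert_semi H2)) // addr0.
have z2 x h : ip (0, x) h = ip2 x h.2.
  by rewrite /ip /dsum_ip /= (semi0l (hilbert_semi H1)) // add0r.
have {c1 c2} c := cvgD (FF := _) (c1 z1) (c2 z2); rewrite addr0 in c.
apply: (eq_cvgn _ (c _)) => n; rewrite addrfctE -mulrDl -big_split /=; congr (_ / _).
rewrite !mul1r bE b1E b2E -big_split /= -sumrB; apply: eq_bigr => i _.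
(* The diagonal entry of the sum frame pairs the dual with [f i] and splits into the diagonal
   entries of the two oblique projections. *)
rewrite -(gram_diag exh H FB) -(gram_diag exh H1 FB1) -(gram_diag exh H2 FB2).
rewrite (gramE exh H FB) {1}/an /ip /dsum_ip ReD /=; ring.
Qed.
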